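(* Let $0<d<\pi/2$ and let $f$ be analytic in $\psi(\mathscr{D}_d)$, where $\psi(\zeta)=\sinh\zeta$. Assume that there exist positive constants $K,\alpha,\beta$ such that $|f(z)|\le K|E_1(z;\alpha)|$ for all $z\in\psi(\mathscr{D}_d^{-})$ and $|f(z)|\le K|E_1(z;\beta)|$ for all $z\in\psi(\mathscr{D}_d^{+})$. Let $\mu=\min\{\alpha,\beta\}$ and $\nu=\max\{\alpha,\beta\}$. For a positive integer $n$ let $h=\sqrt{\pi d/(\mu n)}$, and let $M,N$ be defined by $M=n,\ N=\lceil \alpha n/\beta\rceil$ if $\mu=\alpha$, and $N=n,\ M=\lceil\beta n/\alpha\rceil$ if $\mu=\beta$. Then $$\sup_{t\in(-\infty,\infty)}\left|f(t)-\sum_{k=-M}^{N}f(\psi(kh))\,S(k,h)(\psi^{-1}(t))\right|\le C_1\sqrt{n}\,\mathrm{e}^{-\sqrt{\pi d\mu n}},$$ where $$C_1=\frac{2^{\nu+1}K}{\sqrt{\pi d\mu}}\left\{\frac{2}{\sqrt{\pi d\mu}\,(1-\mathrm{e}^{-2\sqrt{\pi d\mu}})\{\cos d\}^{\nu}}+1\right\}.$$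
   Context: For $d>0$: $\mathscr{D}_d=\{\zeta\in\mathbb{C}:|\operatorname{Im}\zeta|<d\}$, $\mathscr{D}_d^{-}=\{\zeta\in\mathscr{D}_d:\operatorname{Re}\zeta<0\}$, $\mathscr{D}_d^{+}=\{\zeta\in\mathscr{D}_d:\operatorname{Re}\zeta\ge0\}$; $\psi(A)$ is the image of a set $A$ under $\psi$. The Sinc function is $S(k,h)(x)=\frac{\sin[\pi(x/h-k)]}{\pi(x/h-k)}$ (with value $1$ at $x=kh$). $E_1(z;\gamma)=\frac{1}{(1+z^2)^{\gamma/2}}$, so $|E_1(z;\gamma)|=|1+z^2|^{-\gamma/2}$. $\psi^{-1}$ is the inverse of $\psi:\mathbb{R}\to\mathbb{R}$. *)

(* Defs.v *)
From Stdlib Require Import Reals ZArith Lra Lia.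
From Coquelicot Require Import Coquelicot.

Open Scope R_scope.

Definition Cexp (z : C) : C := (exp (Re z) * cos (Im z), exp (Re z) * sin (Im z)).

Definition Csinh (z : C) : C := ((Cexp z - Cexp (- z)) / RtoC 2)%C.

(* Principal argument, with values in (-PI, PI]; the value at 0 is irrelevant. *)
Definition Carg (z : C) : R :=
  if Rle_dec 0 (Im z) then acos (Re z / Cmod z) else - acos (Re z / Cmod z).

Definition Cln (z : C) : C := (ln (Cmod z), Carg z).

(* Principal branch of z ^ a for a real exponent a and z <> 0. *)
Definition Cpower (z : C) (a : R) : C := Cexp (RtoC a * Cln z)%C.

Definition strip (d : R) (z : C) : Prop := Rabs (Im z) < d.
Definition strip_neg (d : R) (z : C) : Prop := strip d z /\ Re z < 0.
Definition strip_pos (d : R) (z : C) : Prop := strip d z /\ 0 <= Re z.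

Definition image (g : C -> C) (A : C -> Prop) (w : C) : Prop :=
  exists z : C, A z /\ w = g z.

(* Analyticity on an open set A: complex differentiability at every point of A,
   the scalars of the derivative being C.  Only the values of f on A matter. *)
Definition analytic_in (f : C -> C) (A : C -> Prop) : Prop :=
  forall z : C, A z -> @ex_derive C_AbsRing C_NormedModule f z.

Definition decayE1 (z : C) (gamma : R) : C :=
  (RtoC 1 / Cpower (RtoC 1 + z * z) (gamma / 2))%C.

Definition Sinc (k : Z) (h x : R) : R :=
  if Req_EM_T x (IZR k * h) then 1
  else sin (PI * (x / h - IZR k)) / (PI * (x / h - IZR k)).

(* F a + F (a + 1) + ... + F b, for a <= b. *)
Definition sum_Z (F : Z -> C) (a b : Z) : C :=
  sum_n (fun j : nat => F (a + Z.of_nat j)%Z) (Z.to_nat (b - a)).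

Definition bound_C1 (d K mu nu : R) : R :=
  Rpower 2 (nu + 1) * K / sqrt (PI * d * mu) *
  (2 / (sqrt (PI * d * mu) * (1 - exp (- (2 * sqrt (PI * d * mu)))) *
        Rpower (cos d) nu)
   + 1).

(* The restriction of Csinh to the real line is the real sinh, whose inverse is
   Stdlib's arcsinh. *)
Lemma Csinh_RtoC (x : R) : Csinh (RtoC x) = RtoC (sinh x).
Proof.
unfold Csinh, Cexp, sinh, RtoC, Cminus, Cdiv, Cinv, Cmult, Cplus, Copp; simpl.
rewrite Ropp_0, cos_0, sin_0.
apply injective_projections; simpl; field.
Qed.

Lemma Cmod_Cexp (z : C) : Cmod (Cexp z) = exp (Re z).
Proof.
unfold Cmod, Cexp; simpl.
replace (_ + _) with (exp (Re z) * exp (Re z) *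
  ((cos (Im z))² + (sin (Im z))²)) by (unfold Rsqr; ring).
rewrite Rplus_comm, sin2_cos2, Rmult_1_r.
apply sqrt_square, Rlt_le, exp_pos.
Qed.

Lemma Cmod_decayE1 (z : C) (gamma : R) :
  Cmod (decayE1 z gamma) = Rpower (Cmod (RtoC 1 + z * z)%C) (- gamma / 2).
Proof.
unfold decayE1.
assert (Hm : Cmod (Cpower (RtoC 1 + z * z)%C (gamma / 2)) =
  Rpower (Cmod (RtoC 1 + z * z)%C) (gamma / 2)).
{ unfold Cpower; rewrite Cmod_Cexp; unfold Rpower.
  f_equal; simpl; ring. }
assert (Hne : Cpower (RtoC 1 + z * z)%C (gamma / 2) <> RtoC 0).
{ intro H0; rewrite H0, Cmod_0 in Hm.
  generalize (exp_pos (gamma / 2 * ln (Cmod (RtoC 1 + z * z)%C))).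
  unfold Rpower in Hm; lra. }
rewrite Cmod_div, Cmod_1, Hm by exact Hne.
replace (- gamma / 2) with (- (gamma / 2)) by field.
rewrite Rpower_Ropp; unfold Rdiv; ring.
Qed.

(* Main.v *)
(* Put F = f o sinh, which is holomorphic on the strip |Im z| < d and satisfies
   |F(u + iv)| <= K (2 / cos d)^g exp(- g |u|), with g = alpha or g = beta
   according to the sign of u, because 1 + sinh^2 = cosh^2 and
   |cosh(u + iv)| >= cosh u cos v.  Integrating
   F(z) / ((z - x) sin(PI z / h)) over the boundary of the rectangle
   [- (m + 1/2) h, (m + 1/2) h] x [-y, y], y < d, the residues at x and at the
   points k h add up to F(x) minus the sinc interpolant with nodes |k| <= m,
   divided by sin(PI x / h).  As m grows the vertical sides disappear, and the
   horizontal ones give the first summand of C_1 when y tends to d.  The second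
   summand bounds the nodes beyond -M and N by geometric series.  Cauchy's theorem
   for rectangles is proved by Goursat's bisection argument. *)
Require Import Defs.
From Stdlib Require Import Reals ZArith Lra Lia List FinFun.
From Coquelicot Require Import Coquelicot.

Open Scope R_scope.

(** * Complex limits and derivatives *)

(** The step [h] balances the two errors: with [sigma = sqrt (PI * d * mu * n)] both [PI / h * d]
    and [mu * n * h] equal [sigma], and [M], [N] are chosen so that [alpha * M] and [beta * N] are
    at least [mu * n]. The factor [sqrt n] comes from the tails alone, through [1 / (mu * h) = sqrt
    n / sqrt (PI * d * mu)]; the discretization error does not produce it and is merely enlarged by
    it. The power of [cos d] enters only the first summand of the constant because the contour lies
    inside the strip, while the nodes are real and there [cos 0 = 1] takes its place. Two obstacles
    shape the argument. If [x] is a node, the denominator of the integrand has a double zero at [x];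
    nodes are therefore treated apart, and there the untruncated interpolant is exact. Moreover [F]
    is controlled only in the open strip, so the contour has height [y < d]; the resulting
    inequality is kept multiplied out, so that both sides are continuous at [y = d]. *)

Definition Clim (g : C -> C) (z l : C) : Prop :=
  forall eps : R, 0 < eps -> exists delta : R, 0 < delta /\
    forall w : C, w <> z -> Cmod (w - z) < delta -> Cmod (g w - l) < eps.

Definition Ccont (g : C -> C) (z : C) : Prop := Clim g z (g z).

Lemma Cmod_minus_0 (z : C) : Cmod (z - z) = 0.
Proof. replace (z - z)%C with (RtoC 0) by ring; apply Cmod_0. Qed.

Lemma Cmod_minus_sym (z w : C) : Cmod (z - w) = Cmod (w - z).
Proof. rewrite <- Cmod_opp; f_equal; ring. Qed.

Lemma Cmod_triangle_minus (z w u : C) :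
  Cmod (z - u) <= Cmod (z - w) + Cmod (w - u).
Proof.
replace (z - u)%C with ((z - w) + (w - u))%C by ring; apply Cmod_triangle.
Qed.

Lemma Cmod_reverse_triangle (z w : C) : Cmod z - Cmod w <= Cmod (z - w).
Proof.
generalize (Cmod_triangle (z - w) w).
replace (z - w + w)%C with z by ring; lra.
Qed.

Lemma Ccont_ball (g : C -> C) (z : C) (eps : R) :
  Ccont g z -> 0 < eps -> exists delta : R, 0 < delta /\
    forall w : C, Cmod (w - z) < delta -> Cmod (g w - g z) < eps.
Proof.
intros Hg He; destruct (Hg eps He) as [de [Hde H]].
exists de; split; auto; intros w Hw.
destruct (Ceq_dec w z) as [->|Hn]; auto.
now rewrite Cmod_minus_0.
Qed.

(** Limits ignore the centre, so agreement on a punctured disc is enough. This is what permits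
    cancelling a factor [z - p] in a residue limit, whatever the quotient is worth at [p]. *)
Lemma Clim_ext_loc (f g : C -> C) (z l : C) (r : R) : 0 < r ->
  (forall w, w <> z -> Cmod (w - z) < r -> f w = g w) ->
  Clim f z l -> Clim g z l.
Proof.
intros Hr Hfg Hf eps He; destruct (Hf eps He) as [de [Hde H]].
exists (Rmin de r); split; [now apply Rmin_glb_lt|].
intros w Hn Hw; rewrite <- Hfg; auto.
- apply H; auto; eapply Rlt_le_trans; [exact Hw|apply Rmin_l].
- eapply Rlt_le_trans; [exact Hw|apply Rmin_r].
Qed.

Lemma Clim_ext (f g : C -> C) (z l : C) :
  (forall w, f w = g w) -> Clim f z l -> Clim g z l.
Proof. intros H; apply (Clim_ext_loc f g z l 1); auto; lra. Qed.

Lemma Clim_const (c z : C) : Clim (fun _ => c) z c.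
Proof.
intros eps He; exists 1; split; [lra|]; intros; now rewrite Cmod_minus_0.
Qed.

Lemma Clim_id (z : C) : Clim (fun w => w) z z.
Proof. intros eps He; exists eps; auto. Qed.

Lemma Clim_plus (f g : C -> C) (z l m : C) :
  Clim f z l -> Clim g z m -> Clim (fun w => f w + g w)%C z (l + m)%C.
Proof.
intros Hf Hg eps He.
destruct (Hf (eps / 2)) as [d1 [Hd1 H1]]; [lra|].
destruct (Hg (eps / 2)) as [d2 [Hd2 H2]]; [lra|].
exists (Rmin d1 d2); split; [now apply Rmin_glb_lt|]; intros w Hn Hw.
replace (_ - _)%C with ((f w - l) + (g w - m))%C by ring.
specialize (H1 w Hn (Rlt_le_trans _ _ _ Hw (Rmin_l _ _))).
specialize (H2 w Hn (Rlt_le_trans _ _ _ Hw (Rmin_r _ _))).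
generalize (Cmod_triangle (f w - l) (g w - m)); lra.
Qed.

Lemma Clim_mult (f g : C -> C) (z l m : C) :
  Clim f z l -> Clim g z m -> Clim (fun w => f w * g w)%C z (l * m)%C.
Proof.
intros Hf Hg eps He.
assert (Hl := Cmod_ge_0 l); assert (Hm := Cmod_ge_0 m).
(* The product differs from [l * m] by at most [e * e + e * Cmod m + e * Cmod l], and [e * e <= e]
   since [e <= 1]. *)
set (e := Rmin 1 (eps / (Cmod l + Cmod m + 2))).
assert (Hp : 0 < eps / (Cmod l + Cmod m + 2)) by (apply Rdiv_lt_0_compat; lra).
assert (He' : 0 < e) by (apply Rmin_glb_lt; lra).
assert (He1 : e <= 1) by apply Rmin_l.
assert (He2 : e * (Cmod l + Cmod m + 2) <= eps).
{ assert (H := Rmin_r 1 (eps / (Cmod l + Cmod m + 2))); fold e in H.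
  apply Rmult_le_compat_r with (r := Cmod l + Cmod m + 2) in H; [|lra].
  unfold Rdiv in H; rewrite Rmult_assoc, Rinv_l, Rmult_1_r in H; lra. }
destruct (Hf e He') as [d1 [Hd1 H1]].
destruct (Hg e He') as [d2 [Hd2 H2]].
exists (Rmin d1 d2); split; [now apply Rmin_glb_lt|]; intros w Hn Hw.
specialize (H1 w Hn (Rlt_le_trans _ _ _ Hw (Rmin_l _ _))).
specialize (H2 w Hn (Rlt_le_trans _ _ _ Hw (Rmin_r _ _))).
replace (_ - _)%C with
  ((f w - l) * (g w - m) + ((f w - l) * m + l * (g w - m)))%C by ring.
eapply Rle_lt_trans; [apply Cmod_triangle|].
eapply Rle_lt_trans; [apply Rplus_le_compat_l, Cmod_triangle|].
rewrite !Cmod_mult.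
assert (Ha := Cmod_ge_0 (f w - l)); assert (Hb := Cmod_ge_0 (g w - m)).
nra.
Qed.

Lemma Clim_opp (f : C -> C) (z l : C) :
  Clim f z l -> Clim (fun w => - f w)%C z (- l)%C.
Proof.
intros H; apply (Clim_ext (fun w => RtoC (-1) * f w)%C); [intros; ring|].
replace (- l)%C with (RtoC (-1) * l)%C by ring.
apply Clim_mult; auto using Clim_const.
Qed.

Lemma Clim_minus (f g : C -> C) (z l m : C) :
  Clim f z l -> Clim g z m -> Clim (fun w => f w - g w)%C z (l - m)%C.
Proof. intros Hf Hg; apply Clim_plus; auto; now apply Clim_opp. Qed.

Lemma Clim_nonzero (f : C -> C) (z l : C) : l <> 0 -> Clim f z l ->
  exists delta, 0 < delta /\
    forall w, w <> z -> Cmod (w - z) < delta -> Cmod l / 2 < Cmod (f w).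
Proof.
intros Hl Hf; apply Cmod_gt_0 in Hl.
destruct (Hf (Cmod l / 2)) as [de [Hde H]]; [lra|].
exists de; split; auto; intros w Hn Hw.
specialize (H w Hn Hw); rewrite Cmod_minus_sym in H.
generalize (Cmod_reverse_triangle l (f w)); lra.
Qed.

Lemma Clim_inv (f : C -> C) (z l : C) : l <> 0 ->
  Clim f z l -> Clim (fun w => / f w)%C z (/ l)%C.
Proof.
intros Hl Hf eps He.
destruct (Clim_nonzero f z l Hl Hf) as [d1 [Hd1 H1]].
assert (Hl' := proj1 (Cmod_gt_0 l) Hl).
(* The difference of inverses is [(l - f w) / (f w * l)], whose denominator exceeds [Cmod l ^ 2 / 2]
   near [z]. *)
destruct (Hf (eps * (Cmod l * Cmod l / 2))) as [d2 [Hd2 H2]].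
{ apply Rmult_lt_0_compat; nra. }
exists (Rmin d1 d2); split; [now apply Rmin_glb_lt|]; intros w Hn Hw.
specialize (H1 w Hn (Rlt_le_trans _ _ _ Hw (Rmin_l _ _))).
specialize (H2 w Hn (Rlt_le_trans _ _ _ Hw (Rmin_r _ _))).
assert (Hw0 : f w <> 0) by (apply Cmod_gt_0; lra).
replace (/ f w - / l)%C with ((l - f w) / (f w * l))%C by (field; auto).
rewrite Cmod_div, Cmod_mult, Cmod_minus_sym by now apply Cmult_neq_0.
apply Rmult_lt_reg_r with (Cmod (f w) * Cmod l); [nra|].
unfold Rdiv; rewrite Rmult_assoc, Rinv_l, Rmult_1_r by nra.
eapply Rlt_le_trans; [exact H2|]; apply Rmult_le_compat_l; nra.
Qed.

Lemma Clim_comp_cont (f g : C -> C) (z l : C) :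
  Ccont f l -> Clim g z l -> Clim (fun w => f (g w)) z (f l).
Proof.
intros Hf Hg eps He.
destruct (Ccont_ball f l eps Hf He) as [d1 [Hd1 H1]].
destruct (Hg d1 Hd1) as [d2 [Hd2 H2]].
exists d2; split; auto.
Qed.

(* Carathéodory's form of complex differentiability: the difference quotient at
   z, completed by l, is continuous at z. *)
Definition Cderiv (g : C -> C) (z l : C) : Prop :=
  exists phi : C -> C,
    (forall w, g w = g z + phi w * (w - z))%C /\ phi z = l /\ Ccont phi z.

Definition Cdiff (g : C -> C) (z : C) : Prop := exists l, Cderiv g z l.

Lemma Cderiv_cont (g : C -> C) (z l : C) : Cderiv g z l -> Ccont g z.
Proof.
intros [phi [H1 [H2 H3]]].
assert (H : Clim (fun w => g z + phi w * (w - z))%C z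
              (g z + phi z * (z - z))%C).
{ apply Clim_plus; [apply Clim_const|].
  apply Clim_mult; auto; apply Clim_minus; [apply Clim_id|apply Clim_const]. }
replace (g z + phi z * (z - z))%C with (g z) in H by ring.
revert H; apply Clim_ext; intros; now rewrite <- H1.
Qed.

Lemma Cdiff_cont (g : C -> C) (z : C) : Cdiff g z -> Ccont g z.
Proof. intros [l Hl]; eapply Cderiv_cont; eauto. Qed.

Lemma Cderiv_const (c z : C) : Cderiv (fun _ => c) z 0.
Proof.
exists (fun _ => RtoC 0); repeat split; [intros; ring|apply Clim_const].
Qed.

Lemma Cderiv_id (z : C) : Cderiv (fun w => w) z 1.
Proof.
exists (fun _ => RtoC 1); repeat split; [intros; ring|apply Clim_const].
Qed.

Lemma Cderiv_plus (f g : C -> C) (z l m : C) :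
  Cderiv f z l -> Cderiv g z m -> Cderiv (fun w => f w + g w)%C z (l + m)%C.
Proof.
intros [p [H1 [H2 H3]]] [q [K1 [K2 K3]]].
exists (fun w => p w + q w)%C; repeat split.
- intros w; rewrite (H1 w), (K1 w); ring.
- now rewrite H2, K2.
- now apply Clim_plus.
Qed.

Lemma Cderiv_mult (f g : C -> C) (z l m : C) :
  Cderiv f z l -> Cderiv g z m ->
  Cderiv (fun w => f w * g w)%C z (l * g z + f z * m)%C.
Proof.
intros [p [H1 [H2 H3]]] Hg; assert (Hc := Cderiv_cont _ _ _ Hg).
destruct Hg as [q [K1 [K2 K3]]].
exists (fun w => p w * g w + f z * q w)%C; repeat split.
- intros w; rewrite (H1 w) at 1; rewrite (K1 w); ring.
- now rewrite H2, K2.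
- apply Clim_plus; apply Clim_mult; auto using Clim_const.
Qed.

Lemma Cderiv_scal (c : C) (g : C -> C) (z l : C) :
  Cderiv g z l -> Cderiv (fun w => c * g w)%C z (c * l)%C.
Proof.
intros H; replace (c * l)%C with (0 * g z + c * l)%C by ring.
apply (Cderiv_mult (fun _ => c)); auto using Cderiv_const.
Qed.

Lemma Cderiv_comp (f g : C -> C) (z l m : C) :
  Cderiv f (g z) l -> Cderiv g z m -> Cderiv (fun w => f (g w)) z (l * m)%C.
Proof.
intros [p [H1 [H2 H3]]] Hg; assert (Hc := Cderiv_cont _ _ _ Hg).
destruct Hg as [q [K1 [K2 K3]]].
exists (fun w => p (g w) * q w)%C; repeat split.
- intros w; rewrite (H1 (g w)).
  assert (E : (g w - g z = q w * (w - z))%C) by (rewrite (K1 w); ring).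
  rewrite E; ring.
- now rewrite H2, K2.
- apply Clim_mult; auto; now apply (Clim_comp_cont p g).
Qed.

Lemma Cinv_0 : (/ RtoC 0)%C = 0.
Proof.
unfold Cinv; simpl.
apply injective_projections; simpl; unfold Rdiv; ring.
Qed.

Lemma Cderiv_inv (z : C) : z <> 0 -> Cderiv Cinv z (- / (z * z))%C.
Proof.
intros Hz.
(* The slope of the inverse between [z] and [w] is [- / (w * z)]. At [w = 0] the convention that the
   inverse of [0] is [0] forces the value [/ (z * z)]; this does not affect continuity at
   [z <> 0]. *)
exists (fun w => if Ceq_dec w 0 then / (z * z) else - / (w * z))%C; repeat split.
- intros w; destruct (Ceq_dec w 0) as [->|Hw].
  + rewrite Cinv_0; field; auto.
  + field; auto.
- now destruct (Ceq_dec z 0).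
- unfold Ccont; destruct (Ceq_dec z 0) as [|_]; [contradiction|].
  destruct (Clim_nonzero _ z z Hz (Clim_id z)) as [r [Hr H]].
  apply (Clim_ext_loc (fun w => - / (w * z))%C _ z _ r); auto.
  + intros w Hn Hw; specialize (H w Hn Hw).
    destruct (Ceq_dec w 0) as [->|]; auto.
    rewrite Cmod_0 in H; generalize (Cmod_ge_0 z); lra.
  + apply Clim_opp, Clim_inv; [now apply Cmult_neq_0|].
    apply Clim_mult; auto using Clim_id, Clim_const.
Qed.

Lemma Cdiff_const (c z : C) : Cdiff (fun _ => c) z.
Proof. eexists; apply Cderiv_const. Qed.

Lemma Cdiff_id (z : C) : Cdiff (fun w => w) z.
Proof. eexists; apply Cderiv_id. Qed.

Lemma Cdiff_mult (f g : C -> C) (z : C) :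
  Cdiff f z -> Cdiff g z -> Cdiff (fun w => f w * g w)%C z.
Proof. intros [l Hl] [m Hm]; eexists; apply Cderiv_mult; eauto. Qed.

Lemma Cdiff_minus (f g : C -> C) (z : C) :
  Cdiff f z -> Cdiff g z -> Cdiff (fun w => f w - g w)%C z.
Proof.
intros [l Hl] [m Hm]; eexists.
apply Cderiv_plus; [apply Hl|].
apply (Cderiv_comp Copp); [|apply Hm].
exists (fun _ => RtoC (-1)); repeat split; [intros; ring|apply Clim_const].
Qed.

Lemma Cdiff_inv (f : C -> C) (z : C) : f z <> 0 ->
  Cdiff f z -> Cdiff (fun w => / f w)%C z.
Proof.
intros Hz [l Hl]; eexists; apply (Cderiv_comp Cinv); eauto.
now apply Cderiv_inv.
Qed.

Lemma Cdiff_div (f g : C -> C) (z : C) : g z <> 0 ->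
  Cdiff f z -> Cdiff g z -> Cdiff (fun w => f w / g w)%C z.
Proof. intros Hz Hf Hg; apply Cdiff_mult; auto; now apply Cdiff_inv. Qed.

(* For [w = z] the quotient below is [0] in Rocq, hence the explicit [l]. *)
Lemma Cderiv_of_estimate (g : C -> C) (z l : C) :
  (forall eps, 0 < eps -> exists delta, 0 < delta /\ forall w,
     Cmod (w - z) < delta ->
     Cmod (g w - g z - l * (w - z)) <= eps * Cmod (w - z)) ->
  Cderiv g z l.
Proof.
intros H.
exists (fun w => if Ceq_dec w z then l else (g w - g z) / (w - z))%C.
repeat split.
- intros w; destruct (Ceq_dec w z) as [->|Hn]; [ring|].
  field; intros H0; apply Hn, Ceq_minus, H0.
- now destruct (Ceq_dec z z).
- unfold Ccont; destruct (Ceq_dec z z) as [_|]; [|congruence].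
  intros eps He; destruct (H (eps / 2)) as [de [Hde Hd]]; [lra|].
  exists de; split; auto; intros w Hn Hw.
  destruct (Ceq_dec w z) as [|_]; [contradiction|].
  assert (Hm : (w - z)%C <> 0) by (intros H0; apply Hn, Ceq_minus, H0).
  replace (_ - l)%C with ((g w - g z - l * (w - z)) / (w - z))%C by (field; auto).
  rewrite Cmod_div by auto; apply Cmod_gt_0 in Hm.
  specialize (Hd w Hw).
  apply Rmult_lt_reg_r with (Cmod (w - z)); auto.
  unfold Rdiv; rewrite Rmult_assoc, Rinv_l, Rmult_1_r; nra.
Qed.

Lemma ex_derive_Cdiff (f : C -> C) (z : C) :
  @ex_derive C_AbsRing C_NormedModule f z -> Cdiff f z.
Proof.
intros [l [_ Hl]]; exists l; apply Cderiv_of_estimate; intros eps He.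
(* [filterdiff] asks for the estimate at every limit of the filter [locally z]; it is taken at [z]
   itself. *)
specialize (Hl z (fun P H => H) (mkposreal eps He)).
destruct Hl as [de Hde].
exists de; split; [apply cond_pos|]; intros w Hw.
assert (E := Hde w Hw).
replace (l * (w - z))%C with ((w - z) * l)%C by ring; exact E.
Qed.

(** * Exponential and hyperbolic functions *)

Lemma Ceq (z w : C) : Re z = Re w -> Im z = Im w -> z = w.
Proof. apply injective_projections. Qed.

Lemma Cmod_le_Re_Im (z : C) : Cmod z <= Rabs (Re z) + Rabs (Im z).
Proof.
replace z with (RtoC (Re z) + Ci * RtoC (Im z))%C at 1
  by (apply Ceq; simpl; ring).
eapply Rle_trans; [apply Cmod_triangle|].
rewrite Cmod_mult, Cmod_Ci, !Cmod_R; lra.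
Qed.

Lemma im_le_Cmod (z : C) : Rabs (Im z) <= Cmod z.
Proof. eapply Rle_trans; [apply Rmax_r|apply Rmax_Cmod]. Qed.

Lemma Rabs_sin_le (x : R) : Rabs (sin x) <= Rabs x.
Proof.
destruct (MVT_gen sin 0 x cos) as [c [_ Hc]].
- intros y _; apply is_derive_sin.
- intros y _; apply continuity_sin.
- rewrite sin_0, !Rminus_0_r in Hc; rewrite Hc, Rabs_mult.
  generalize (Rabs_pos x) (COS_bound c); intros Hx Hcos.
  assert (Rabs (cos c) <= 1) by (apply Rabs_le; lra); nra.
Qed.

Lemma one_minus_cos_le (x : R) : 0 <= 1 - cos x <= x ^ 2 / 2.
Proof.
split; [generalize (COS_bound x); lra|].
replace x with (2 * (x / 2)) at 1 by field.
rewrite cos_2a_sin.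
assert (H := Rabs_sin_le (x / 2)); apply Rsqr_le_abs_1 in H.
unfold Rsqr in H; nra.
Qed.

Lemma Rabs_sin_minus_le (x : R) : Rabs x <= 1 -> Rabs (sin x - x) <= x ^ 2.
Proof.
intros Hx1.
destruct (MVT_gen (fun y => sin y - y) 0 x (fun y => cos y - 1)) as [c [Hc1 Hc]].
- intros y _; auto_derive; auto; ring.
- intros y _; apply continuity_pt_minus;
    [apply continuity_sin|apply continuity_pt_id].
- simpl in Hc; rewrite sin_0, !Rminus_0_r in Hc; rewrite Hc, Rabs_mult.
  assert (H := one_minus_cos_le c).
  assert (Hcx : Rabs c <= Rabs x).
  { unfold Rmin, Rmax in Hc1; destruct (Rle_dec 0 x);
      unfold Rabs; destruct (Rcase_abs c), (Rcase_abs x); lra. }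
  assert (H2 := Rabs_pos c); assert (H3 := Rabs_pos x).
  rewrite <- (pow2_abs c) in H.
  rewrite <- (pow2_abs x).
  replace (cos c - 1) with (- (1 - cos c)) by ring.
  rewrite Rabs_Ropp, (Rabs_pos_eq (1 - cos c)) by lra.
  nra.
Qed.

Lemma exp_minus_1_minus_id (x : R) : Rabs x <= 1 / 2 ->
  0 <= exp x - 1 - x <= 2 * x ^ 2.
Proof.
intros Hx; apply Rabs_le_between in Hx.
split; [generalize (exp_ineq1_le x); lra|].
assert (H := exp_ineq1_le (- x)); rewrite exp_Ropp in H.
assert (He := exp_pos x).
apply Rmult_le_compat_r with (r := exp x) in H; [|lra].
rewrite Rinv_l in H by lra.
(* The left side is at most [1] by the inequality for [exp (- x)], and the right side is
   [1 + x ^ 2 * (1 - 2 * x)], at least [1] for [x <= 1 / 2]. *)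
assert (exp x * (1 - x) <= (1 + x + 2 * x ^ 2) * (1 - x)) by nra.
apply Rmult_le_reg_r in H0; lra.
Qed.

Lemma Cexp_estimate (z : C) : Cmod z <= 1 / 2 ->
  Cmod (Cexp z - 1 - z) <= 3 * Cmod z ^ 2.
Proof.
intros Hz; assert (Hre := re_le_Cmod z); assert (Him := im_le_Cmod z).
rewrite Cmod2_alt; destruct z as [u v]; simpl in Hre, Him.
assert (Hu : Rabs u <= 1 / 2) by lra; assert (Hv : Rabs v <= 1 / 2) by lra.
eapply Rle_trans; [apply Cmod_le_Re_Im|]; simpl.
replace (exp u * cos v + - (1) + - u) with
  ((exp u - 1 - u) * cos v - (1 + u) * (1 - cos v)) by ring.
replace (exp u * sin v + - 0 + - v) with
  ((exp u - 1 - u + u) * sin v + (sin v - v)) by ring.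
assert (H1 := exp_minus_1_minus_id u Hu); set (e := exp u - 1 - u) in *.
assert (H2 := one_minus_cos_le v); set (k := 1 - cos v) in *.
assert (H3 : Rabs (sin v - v) <= v ^ 2) by (apply Rabs_sin_minus_le; lra).
assert (H4 := Rabs_sin_le v).
assert (Hu2 := pow2_abs u); assert (Hv2 := pow2_abs v).
assert (Hu0 := Rabs_pos u); assert (Hv0 := Rabs_pos v).
assert (A1 : Rabs (e * cos v - (1 + u) * k) <= 2 * u ^ 2 + v ^ 2).
{ apply Rabs_le_between in Hu.
  assert (C := COS_bound v).
  assert (- e <= e * cos v <= e) by nra.
  assert (0 <= (1 + u) * k <= 2 * k) by nra.
  apply Rabs_le; lra. }
assert (A2 : Rabs ((e + u) * sin v + (sin v - v)) <=
             2 * (Rabs u * Rabs v) + v ^ 2).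
{ eapply Rle_trans; [apply Rabs_triang|]; rewrite Rabs_mult.
  assert (Rabs (e + u) <= 2 * Rabs u).
  { eapply Rle_trans; [apply Rabs_triang|].
    rewrite (Rabs_pos_eq e) by lra; nra. }
  assert (Rabs (e + u) * Rabs (sin v) <= 2 * Rabs u * Rabs v)
    by (apply Rmult_le_compat; auto using Rabs_pos).
  lra. }
(* The two parts add up to [2 * u ^ 2 + 2 * v ^ 2 + 2 * Rabs u * Rabs v]; this square turns the
   mixed term into [u ^ 2 + v ^ 2], whence the factor [3]. *)
assert (A3 : 0 <= (Rabs u - Rabs v) ^ 2) by apply pow2_ge_0.
simpl in *; nra.
Qed.

Lemma Cexp_plus (z w : C) : Cexp (z + w) = (Cexp z * Cexp w)%C.
Proof.
unfold Cexp; destruct z as [a b], w as [c d]; simpl.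
rewrite exp_plus, cos_plus, sin_plus; apply Ceq; simpl; ring.
Qed.

(** The addition formula moves the question to the origin, where the quadratic estimate applies with
    the extra factor [Cmod (Cexp z)]. *)
Lemma Cderiv_Cexp (z : C) : Cderiv Cexp z (Cexp z).
Proof.
apply Cderiv_of_estimate; intros eps He.
assert (Hz : 0 < Cmod (Cexp z)) by (rewrite Cmod_Cexp; apply exp_pos).
set (m := Cmod (Cexp z)) in *.
exists (Rmin (1 / 2) (eps / (3 * m))); split.
{ apply Rmin_glb_lt; [lra|]; apply Rdiv_lt_0_compat; lra. }
intros w Hw.
assert (Hw1 := Rlt_le_trans _ _ _ Hw (Rmin_l _ _)).
assert (Hw2 := Rlt_le_trans _ _ _ Hw (Rmin_r _ _)).
replace w with (z + (w - z))%C at 1 by ring; rewrite Cexp_plus.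
replace (_ - _ - _)%C with (Cexp z * (Cexp (w - z) - 1 - (w - z)))%C by ring.
rewrite Cmod_mult; fold m.
assert (H := Cexp_estimate (w - z) (Rlt_le _ _ Hw1)).
assert (Hp := Cmod_ge_0 (w - z)).
apply Rmult_lt_compat_r with (r := 3 * m) in Hw2; [|lra].
unfold Rdiv in Hw2; rewrite Rmult_assoc, Rinv_l, Rmult_1_r in Hw2 by lra.
apply Rle_trans with (m * (3 * Cmod (w - z) ^ 2)).
- apply Rmult_le_compat_l; lra.
- replace (m * _) with ((Cmod (w - z) * (3 * m)) * Cmod (w - z)) by ring.
  apply Rmult_le_compat_r; lra.
Qed.

Definition Ccosh (z : C) : C := ((Cexp z + Cexp (- z)) / RtoC 2)%C.

Lemma RtoC_2_neq_0 : RtoC 2 <> 0.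
Proof. intros H; injection H; lra. Qed.

Lemma Cderiv_Csinh (z : C) : Cderiv Csinh z (Ccosh z).
Proof.
unfold Csinh, Ccosh.
(* This is the derivative in the shape delivered by the product, sum and chain rules. *)
replace ((Cexp z + Cexp (- z)) / RtoC 2)%C with
  ((Cexp z + (- 1) * (Cexp (- z) * (- 1))) * / RtoC 2
    + (Cexp z - Cexp (- z)) * 0)%C by (field; apply RtoC_2_neq_0).
apply (Cderiv_mult (fun w => Cexp w - Cexp (- w))%C (fun _ => / RtoC 2)%C);
  [|apply Cderiv_const].
assert (Hopp : forall w, Cderiv Copp w (- 1)).
{ intros w; exists (fun _ => (- 1)%C); repeat split;
    [intros; ring|apply Clim_const]. }
apply (Cderiv_plus Cexp (fun w => - Cexp (- w))%C); [apply Cderiv_Cexp|].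
apply (Cderiv_comp Copp (fun w => Cexp (- w))); [apply Hopp|].
apply (Cderiv_comp Cexp Copp); [apply Cderiv_Cexp|apply Hopp].
Qed.

Lemma Csinh_eq (u v : R) : Csinh (u, v) = (sinh u * cos v, cosh u * sin v).
Proof.
unfold Csinh, Cexp, sinh, cosh; simpl; rewrite cos_neg, sin_neg.
apply Ceq; simpl; field.
Qed.

Lemma Ccosh_eq (u v : R) : Ccosh (u, v) = (cosh u * cos v, sinh u * sin v).
Proof.
unfold Ccosh, Cexp, sinh, cosh; simpl; rewrite cos_neg, sin_neg.
apply Ceq; simpl; field.
Qed.

Lemma cosh_sqr (u : R) : cosh u ^ 2 = 1 + sinh u ^ 2.
Proof.
unfold cosh, sinh.
assert (H : exp u * exp (- u) = 1) by (rewrite <- exp_plus, Rplus_opp_r; apply exp_0).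
nra.
Qed.

Lemma sin_sqr (v : R) : sin v ^ 2 = 1 - cos v ^ 2.
Proof. generalize (sin2_cos2 v); unfold Rsqr; nra. Qed.

(** Each square alone is a lower bound for the modulus: one is used on the horizontal sides of the
    contour, the other on the vertical sides. *)
Lemma Cmod_Csinh_sqr (u v : R) : Cmod (Csinh (u, v)) ^ 2 = sinh u ^ 2 + sin v ^ 2.
Proof.
rewrite Csinh_eq, Cmod2_alt; simpl Re; simpl Im.
rewrite !Rpow_mult_distr, cosh_sqr, sin_sqr; ring.
Qed.

Lemma one_plus_Csinh_sqr (z : C) :
  (1 + Csinh z * Csinh z)%C = (Ccosh z * Ccosh z)%C.
Proof.
assert (H : (Cexp z * Cexp (- z))%C = 1).
{ rewrite <- Cexp_plus; replace (z + - z)%C with (RtoC 0) by ring.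
  unfold Cexp; simpl; rewrite exp_0, cos_0, sin_0; apply Ceq; simpl; ring. }
unfold Csinh, Ccosh.
replace (RtoC 1) with (Cexp z * Cexp (- z))%C at 1 by exact H.
field; apply RtoC_2_neq_0.
Qed.

(** * Integrals of complex-valued functions *)

Definition CInt (f : R -> C) (a b : R) : C :=
  (RInt (fun t => Re (f t)) a b, RInt (fun t => Im (f t)) a b).

Definition Cint_able (f : R -> C) (a b : R) : Prop :=
  ex_RInt (fun t => Re (f t)) a b /\ ex_RInt (fun t => Im (f t)) a b.

(** A path that does not increase distances carries continuity of [g] over to both real components
    of the integrand; horizontal and vertical segments are the two cases needed. *)
Lemma Cint_able_path (g : C -> C) (p : R -> C) (a b : R) : a <= b ->
  (forall s t, Cmod (p s - p t) <= Rabs (s - t)) ->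
  (forall t, a <= t <= b -> Ccont g (p t)) -> Cint_able (fun t => g (p t)) a b.
Proof.
intros Hab Hp Hg; split; apply (@ex_RInt_continuous R_CompleteNormedModule);
  rewrite Rmin_left, Rmax_right by lra; intros t Ht P [e HP];
  destruct (Ccont_ball g (p t) e (Hg t Ht) (cond_pos e)) as [de [Hde H]];
  exists (mkposreal de Hde); intros s Hs; apply HP;
  specialize (H (p s) (Rle_lt_trans _ _ _ (Hp s t) Hs));
  eapply Rle_lt_trans; [|exact H| |exact H].
- apply (re_le_Cmod (g (p s) - g (p t))).
- apply (im_le_Cmod (g (p s) - g (p t))).
Qed.

Lemma CInt_ext (f g : R -> C) (a b : R) : a <= b ->
  (forall t, a <= t <= b -> f t = g t) -> CInt f a b = CInt g a b.
Proof.
intros Hab H; unfold CInt; f_equal; apply RInt_ext;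
  rewrite Rmin_left, Rmax_right by lra; intros t Ht; rewrite H; auto; lra.
Qed.

Lemma CInt_minus (f g : R -> C) (a b : R) :
  Cint_able f a b -> Cint_able g a b ->
  CInt (fun t => f t - g t)%C a b = (CInt f a b - CInt g a b)%C.
Proof.
intros [Hf1 Hf2] [Hg1 Hg2]; apply Ceq; simpl.
- apply (RInt_minus (V := R_CompleteNormedModule)); auto.
- apply (RInt_minus (V := R_CompleteNormedModule)); auto.
Qed.

Lemma CInt_Chasles (f : R -> C) (a b c : R) :
  Cint_able f a b -> Cint_able f b c ->
  CInt f a c = (CInt f a b + CInt f b c)%C.
Proof.
intros [Hf1 Hf2] [Hg1 Hg2]; apply Ceq; simpl; symmetry;
  apply (RInt_Chasles (V := R_CompleteNormedModule)); auto.
Qed.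

Lemma CInt_affine (A B : C) (a b : R) :
  CInt (fun t => A + B * RtoC t)%C a b =
  (A * RtoC (b - a) + B * RtoC ((b ^ 2 - a ^ 2) / 2))%C.
Proof.
apply Ceq; simpl.
- replace (RInt _ a b) with
    (RInt (fun t => Re A + Re B * t) a b)
    by (apply RInt_ext; intros t _; unfold Re; simpl; ring).
  apply is_RInt_unique.
  replace (_ + _) with ((Re A * b + Re B * b ^ 2 / 2) -
    (Re A * a + Re B * a ^ 2 / 2)) by (unfold Re; simpl; field).
  apply (is_RInt_derive (V := R_CompleteNormedModule)
    (fun t => Re A * t + Re B * t ^ 2 / 2)).
  + intros t _; auto_derive; auto; field.
  + intros t _; apply (ex_derive_continuous (fun t => Re A + Re B * t)).
    auto_derive; auto.
- replace (RInt _ a b) with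
    (RInt (fun t => Im A + Im B * t) a b)
    by (apply RInt_ext; intros t _; unfold Im; simpl; ring).
  apply is_RInt_unique.
  replace (_ + _) with ((Im A * b + Im B * b ^ 2 / 2) -
    (Im A * a + Im B * a ^ 2 / 2)) by (unfold Im; simpl; field).
  apply (is_RInt_derive (V := R_CompleteNormedModule)
    (fun t => Im A * t + Im B * t ^ 2 / 2)).
  + intros t _; auto_derive; auto; field.
  + intros t _; apply (ex_derive_continuous (fun t => Im A + Im B * t)).
    auto_derive; auto.
Qed.

Lemma ex_RInt_scal_R (f : R -> R) (k a b : R) :
  ex_RInt f a b -> ex_RInt (fun t => k * f t) a b.
Proof. intros H; exact (ex_RInt_scal (V := R_NormedModule) f a b k H). Qed.

(* Integrate [Re (conj I * f)], where [I] is the integral of [f]. *)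
Lemma CInt_bound (f : R -> C) (g : R -> R) (a b : R) : a <= b ->
  Cint_able f a b -> ex_RInt g a b ->
  (forall t, a < t < b -> Cmod (f t) <= g t) -> Cmod (CInt f a b) <= RInt g a b.
Proof.
intros Hab [H1 H2] Hg H.
destruct (Ceq_dec (CInt f a b) 0) as [E|E].
- rewrite E, Cmod_0.
  replace 0 with (RInt (fun _ => 0) a b)
    by (rewrite RInt_const; apply Rmult_0_r).
  apply RInt_le; auto; [apply ex_RInt_const|].
  intros t Ht; generalize (H t Ht) (Cmod_ge_0 (f t)); lra.
- apply Cmod_gt_0 in E; set (I := CInt f a b) in *.
  apply Rmult_le_reg_l with (Cmod I); auto.
  replace (Cmod I * Cmod I) with (Cmod I ^ 2) by ring; rewrite Cmod2_alt.
  rewrite <- (RInt_scal (V := R_CompleteNormedModule)) by exact Hg.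
  replace (Re I ^ 2 + Im I ^ 2) with
    (RInt (fun t => Re I * Re (f t) + Im I * Im (f t)) a b).
  + apply RInt_le; auto.
    * apply (ex_RInt_plus (V := R_NormedModule)); now apply ex_RInt_scal_R.
    * now apply ex_RInt_scal_R.
    * intros t Ht; change (scal (Cmod I) (g t)) with (Cmod I * g t).
      apply Rle_trans with (Cmod (Cconj I * f t)).
      -- eapply Rle_trans; [|apply re_le_Cmod].
         eapply Rle_trans; [|apply Rle_abs]; simpl; unfold Re, Im; lra.
      -- rewrite Cmod_mult, Cmod_conj.
         apply Rmult_le_compat_l; [apply Cmod_ge_0|auto].
  + rewrite (RInt_plus (V := R_CompleteNormedModule)) by now apply ex_RInt_scal_R.
    rewrite !(RInt_scal (V := R_CompleteNormedModule)) by auto.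
    change (Re I * RInt (fun t => Re (f t)) a b +
            Im I * RInt (fun t => Im (f t)) a b = Re I ^ 2 + Im I ^ 2).
    change (Re I * Re I + Im I * Im I = Re I ^ 2 + Im I ^ 2); ring.
Qed.

Lemma CInt_bound_const (f : R -> C) (B a b : R) : a <= b ->
  Cint_able f a b -> (forall t, a < t < b -> Cmod (f t) <= B) ->
  Cmod (CInt f a b) <= (b - a) * B.
Proof.
intros Hab Hf H.
replace ((b - a) * B) with (RInt (fun _ => B) a b) by (rewrite RInt_const; reflexivity).
apply CInt_bound; auto; apply ex_RInt_const.
Qed.

(** * Goursat's theorem for rectangles *)

Definition in_rect (a b c d : R) (z : C) : Prop :=
  a <= Re z <= b /\ c <= Im z <= d.

Definition on_edge (a b c d : R) (z : C) : Prop :=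
  in_rect a b c d z /\ (Re z = a \/ Re z = b \/ Im z = c \/ Im z = d).

Definition edge_cont (g : C -> C) (a b c d : R) : Prop :=
  forall z, on_edge a b c d z -> Ccont g z.

(** The counterclockwise contour integral: the top and left sides run backwards, and [Ci] is the
    derivative of the parametrization of the vertical sides. *)
Definition rect_int (g : C -> C) (a b c d : R) : C :=
  (CInt (fun t => g (t, c)) a b - CInt (fun t => g (t, d)) a b +
   Ci * (CInt (fun t => g (b, t)) c d - CInt (fun t => g (a, t)) c d))%C.

Lemma Cint_able_horizontal (g : C -> C) (a b y : R) : a <= b ->
  (forall t, a <= t <= b -> Ccont g (t, y)) -> Cint_able (fun t => g (t, y)) a b.
Proof.
intros Hab H; apply (Cint_able_path g (fun t => (t, y))); auto.
intros s t; rewrite <- Cmod_R; right; f_equal; apply Ceq; simpl; ring.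
Qed.

Lemma Cint_able_vertical (g : C -> C) (a b x : R) : a <= b ->
  (forall t, a <= t <= b -> Ccont g (x, t)) -> Cint_able (fun t => g (x, t)) a b.
Proof.
intros Hab H; apply (Cint_able_path g (fun t => (x, t))); auto.
intros s t; replace ((x, s) - (x, t))%C with (Ci * RtoC (s - t))%C
  by (apply Ceq; simpl; ring).
rewrite Cmod_mult, Cmod_Ci, Cmod_R; lra.
Qed.

Lemma edge_cont_int_able (g : C -> C) (a b c d : R) : a <= b -> c <= d ->
  edge_cont g a b c d ->
  Cint_able (fun t => g (t, c)) a b /\ Cint_able (fun t => g (t, d)) a b /\
  Cint_able (fun t => g (b, t)) c d /\ Cint_able (fun t => g (a, t)) c d.
Proof.
intros Hab Hcd H; split; [|split; [|split]];
  [apply Cint_able_horizontal | apply Cint_able_horizontal |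
   apply Cint_able_vertical | apply Cint_able_vertical]; auto;
  intros t Ht; apply H; unfold on_edge, in_rect; simpl; lra.
Qed.

Lemma edge_cont_minus (f g : C -> C) (a b c d : R) :
  edge_cont f a b c d -> edge_cont g a b c d ->
  edge_cont (fun z => f z - g z)%C a b c d.
Proof. intros Hf Hg z Hz; apply Clim_minus; [now apply Hf|now apply Hg]. Qed.

Lemma rect_int_minus (f g : C -> C) (a b c d : R) : a <= b -> c <= d ->
  edge_cont f a b c d -> edge_cont g a b c d ->
  rect_int (fun z => f z - g z)%C a b c d =
  (rect_int f a b c d - rect_int g a b c d)%C.
Proof.
intros Hab Hcd Hf Hg.
destruct (edge_cont_int_able f a b c d Hab Hcd Hf) as [F1 [F2 [F3 F4]]].
destruct (edge_cont_int_able g a b c d Hab Hcd Hg) as [G1 [G2 [G3 G4]]].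
unfold rect_int; rewrite !CInt_minus by assumption; ring.
Qed.

Lemma rect_int_bound (g : C -> C) (a b c d B : R) : a <= b -> c <= d ->
  edge_cont g a b c d ->
  (forall z, on_edge a b c d z -> Cmod (g z) <= B) ->
  Cmod (rect_int g a b c d) <= 2 * (b - a + (d - c)) * B.
Proof.
intros Hab Hcd Hg H.
destruct (edge_cont_int_able g a b c d Hab Hcd Hg) as [G1 [G2 [G3 G4]]].
unfold rect_int.
apply CInt_bound_const with (B := B) in G1; auto;
  [|intros; apply H; unfold on_edge, in_rect; simpl; lra].
apply CInt_bound_const with (B := B) in G2; auto;
  [|intros; apply H; unfold on_edge, in_rect; simpl; lra].
apply CInt_bound_const with (B := B) in G3; auto;
  [|intros; apply H; unfold on_edge, in_rect; simpl; lra].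
apply CInt_bound_const with (B := B) in G4; auto;
  [|intros; apply H; unfold on_edge, in_rect; simpl; lra].
eapply Rle_trans; [apply Cmod_triangle|].
rewrite Cmod_mult, Cmod_Ci.
generalize (Cmod_triangle (CInt (fun t => g (t, c)) a b)
              (- CInt (fun t => g (t, d)) a b))
  (Cmod_triangle (CInt (fun t => g (b, t)) c d)
              (- CInt (fun t => g (a, t)) c d)).
rewrite !Cmod_opp; unfold Cminus; lra.
Qed.

(** Computed outright from primitives on the sides. In the bisection argument it lets the tangent
    map of [g] be subtracted at no cost. *)
Lemma rect_int_affine (A B : C) (a b c d : R) : a <= b -> c <= d ->
  rect_int (fun z => A + B * z)%C a b c d = 0.
Proof.
intros Hab Hcd.
assert (Hh : forall y, CInt (fun t => A + B * (t, y))%C a b =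
  CInt (fun t => (A + B * (Ci * RtoC y)) + B * RtoC t)%C a b).
{ intros y; apply CInt_ext; auto; intros t _.
  replace ((t, y) : C) with (RtoC t + Ci * RtoC y)%C
    by (apply Ceq; simpl; ring); ring. }
assert (Hv : forall x, CInt (fun t => A + B * (x, t))%C c d =
  CInt (fun t => (A + B * RtoC x) + (B * Ci) * RtoC t)%C c d).
{ intros x; apply CInt_ext; auto; intros t _.
  replace ((x, t) : C) with (RtoC x + Ci * RtoC t)%C
    by (apply Ceq; simpl; ring); ring. }
unfold rect_int; rewrite !Hh, !Hv, !CInt_affine.
rewrite !RtoC_minus; apply Ceq; simpl; field.
Qed.

Lemma rect_int_split_v (g : C -> C) (a m b c d : R) : a <= m <= b -> c <= d ->
  edge_cont g a m c d -> edge_cont g m b c d ->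
  rect_int g a b c d = (rect_int g a m c d + rect_int g m b c d)%C.
Proof.
intros Hm Hcd H1 H2.
destruct (edge_cont_int_able g a m c d (proj1 Hm) Hcd H1) as [F1 [F2 _]].
destruct (edge_cont_int_able g m b c d (proj2 Hm) Hcd H2) as [G1 [G2 _]].
unfold rect_int.
rewrite (CInt_Chasles (fun t => g (t, c)) a m b),
  (CInt_Chasles (fun t => g (t, d)) a m b) by assumption; ring.
Qed.

Lemma rect_int_split_h (g : C -> C) (a b c m d : R) : a <= b -> c <= m <= d ->
  edge_cont g a b c m -> edge_cont g a b m d ->
  rect_int g a b c d = (rect_int g a b c m + rect_int g a b m d)%C.
Proof.
intros Hab Hm H1 H2.
destruct (edge_cont_int_able g a b c m Hab (proj1 Hm) H1) as [_ [_ [F3 F4]]].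
destruct (edge_cont_int_able g a b m d Hab (proj2 Hm) H2) as [_ [_ [G3 G4]]].
unfold rect_int.
rewrite (CInt_Chasles (fun t => g (b, t)) c m d),
  (CInt_Chasles (fun t => g (a, t)) c m d) by assumption; ring.
Qed.

Lemma diff_edge_cont (g : C -> C) (a b c d a' b' c' d' : R) :
  a <= a' -> b' <= b -> c <= c' -> d' <= d ->
  (forall z, in_rect a b c d z -> Cdiff g z) -> edge_cont g a' b' c' d'.
Proof.
intros Ha Hb Hc Hd H z [Hz _]; apply Cdiff_cont, H.
unfold in_rect in *; lra.
Qed.

Record box := Box { bxa : R; bxb : R; bxc : R; bxd : R }.

Definition box_int (g : C -> C) (r : box) : R :=
  Cmod (rect_int g (bxa r) (bxb r) (bxc r) (bxd r)).

(** The first quarter whose contour integral keeps a fourth of the modulus. The last one is the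
    default, justified by pigeonhole: the four integrals add up to that of [r], since the inner
    sides cancel. *)
Definition quarter (g : C -> C) (r : box) : box :=
  let (a, b, c, d) := r in
  let x := (a + b) / 2 in let y := (c + d) / 2 in
  let q := box_int g r / 4 in
  if Rle_dec q (box_int g (Box a x c y)) then Box a x c y
  else if Rle_dec q (box_int g (Box x b c y)) then Box x b c y
  else if Rle_dec q (box_int g (Box a x y d)) then Box a x y d
  else Box x b y d.

Arguments quarter : simpl never.

Lemma quarter_spec (g : C -> C) (a b c d a1 b1 c1 d1 : R) :
  a <= b -> c <= d -> (forall z, in_rect a b c d z -> Cdiff g z) ->
  quarter g (Box a b c d) = Box a1 b1 c1 d1 ->
  box_int g (Box a b c d) / 4 <= box_int g (Box a1 b1 c1 d1) /\
  a <= a1 /\ b1 <= b /\ c <= c1 /\ d1 <= d /\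
  b1 - a1 = (b - a) / 2 /\ d1 - c1 = (d - c) / 2.
Proof.
intros Hab Hcd Hg; unfold quarter.
set (x := (a + b) / 2); set (y := (c + d) / 2).
assert (Hx : 2 * x = a + b) by (unfold x; field).
assert (Hy : 2 * y = c + d) by (unfold y; field).
assert (Hsum : box_int g (Box a b c d) <=
  box_int g (Box a x c y) + box_int g (Box x b c y) +
  (box_int g (Box a x y d) + box_int g (Box x b y d))).
{ unfold box_int; simpl.
  rewrite (rect_int_split_h g a b c y d), (rect_int_split_v g a x b c y),
    (rect_int_split_v g a x b y d) by
    first [lra | apply (diff_edge_cont g a b c d); auto; lra].
  eapply Rle_trans; [apply Cmod_triangle|].
  apply Rplus_le_compat; apply Cmod_triangle. }
destruct (Rle_dec _ (box_int g (Box a x c y))) as [H1|H1];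
  [|destruct (Rle_dec _ (box_int g (Box x b c y))) as [H2|H2];
    [|destruct (Rle_dec _ (box_int g (Box a x y d))) as [H3|H3]]];
  intros E; injection E; intros <- <- <- <-; repeat split; lra.
Qed.

(** Every lower end is below every upper end, so the supremum of the lower ends lies in all the
    intervals. *)
Lemma nested_limit (lo hi : nat -> R) :
  (forall n k, lo n <= lo (n + k)%nat <= hi n) ->
  (forall n k, hi (n + k)%nat <= hi n) ->
  exists x, forall n, lo n <= x <= hi n.
Proof.
intros Hl Hh.
assert (H : forall m n, lo m <= hi n).
{ intros m n; destruct (Nat.le_ge_cases m n) as [L|L].
  - replace n with (m + (n - m))%nat by lia.
    apply Rle_trans with (lo (m + (n - m))%nat); [apply Hl|].
    generalize (Hl (m + (n - m))%nat 0%nat); rewrite Nat.add_0_r; lra.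
  - replace m with (n + (m - n))%nat by lia; apply Hl. }
destruct (completeness (fun x => exists n, x = lo n)) as [x [Hx1 Hx2]].
- exists (hi 0%nat); intros y [n ->]; apply H.
- exists (lo 0%nat), 0%nat; reflexivity.
- exists x; intros n; split; [apply Hx1; now exists n|].
  apply Hx2; intros y [m ->]; apply H.
Qed.

Section Goursat.
Variables (g : C -> C) (a b c d : R).
Hypotheses (Hab : a <= b) (Hcd : c <= d).
Hypothesis Hg : forall z, in_rect a b c d z -> Cdiff g z.

Fixpoint nested (n : nat) : box :=
  match n with O => Box a b c d | S k => quarter g (nested k) end.

Lemma nested_spec (n : nat) :
  let r := nested n in
  a <= bxa r /\ bxb r <= b /\ c <= bxc r /\ bxd r <= d /\
  bxb r - bxa r = (b - a) / 2 ^ n /\ bxd r - bxc r = (d - c) / 2 ^ n /\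
  box_int g (Box a b c d) / 4 ^ n <= box_int g r.
Proof.
induction n as [|n IH]; simpl; [repeat split; lra|].
simpl in IH; destruct (nested n) as [a0 b0 c0 d0]; simpl in IH.
destruct (quarter g (Box a0 b0 c0 d0)) as [a1 b1 c1 d1] eqn:E.
assert (Hp : 0 < 2 ^ n) by (apply pow_lt; lra).
assert (Hp4 : 0 < 4 ^ n) by (apply pow_lt; lra).
assert (H1 : 0 <= (b - a) / 2 ^ n) by (apply Rdiv_le_0_compat; lra).
assert (H2 : 0 <= (d - c) / 2 ^ n) by (apply Rdiv_le_0_compat; lra).
destruct (quarter_spec g a0 b0 c0 d0 a1 b1 c1 d1) as (Q1&Q2&Q3&Q4&Q5&Q6&Q7);
  try lra; auto.
{ intros z Hz; apply Hg; unfold in_rect in *; lra. }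
simpl; repeat split; try lra.
- replace ((b - a) / (2 * 2 ^ n)) with ((b - a) / 2 ^ n / 2) by (field; lra); lra.
- replace ((d - c) / (2 * 2 ^ n)) with ((d - c) / 2 ^ n / 2) by (field; lra); lra.
- replace (_ / (4 * 4 ^ n)) with (box_int g (Box a b c d) / 4 ^ n / 4)
    by (field; lra); lra.
Qed.

Lemma nested_sub (n k : nat) :
  bxa (nested n) <= bxa (nested (n + k)) <= bxb (nested n) /\
  bxc (nested n) <= bxc (nested (n + k)) <= bxd (nested n) /\
  bxb (nested (n + k)) <= bxb (nested n) /\
  bxd (nested (n + k)) <= bxd (nested n).
Proof.
assert (W : forall m, bxa (nested m) <= bxb (nested m) /\
                      bxc (nested m) <= bxd (nested m)).
{ intros m; destruct (nested_spec m) as (_&_&_&_&H1&H2&_).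
  assert (Hp : 0 < 2 ^ m) by (apply pow_lt; lra).
  assert (0 <= (b - a) / 2 ^ m) by (apply Rdiv_le_0_compat; lra).
  assert (0 <= (d - c) / 2 ^ m) by (apply Rdiv_le_0_compat; lra); lra. }
induction k as [|k IH].
- rewrite Nat.add_0_r; generalize (W n); lra.
- rewrite Nat.add_succ_r; simpl.
  destruct (nested_spec (n + k)) as (S1&S2&S3&S4&_).
  assert (W1 := W (n + k)%nat); assert (W2 := W (S (n + k))); simpl in W2.
  destruct (nested (n + k)) as [a0 b0 c0 d0]; simpl in *.
  destruct (quarter g (Box a0 b0 c0 d0)) as [a1 b1 c1 d1] eqn:E.
  destruct (quarter_spec g a0 b0 c0 d0 a1 b1 c1 d1) as (Q1&Q2&Q3&Q4&Q5&Q6&Q7);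
    try lra; auto.
  { intros z Hz; apply Hg; unfold in_rect in *; lra. }
  simpl in *; lra.
Qed.

Theorem Goursat_rectangle : rect_int g a b c d = 0.
Proof.
apply Cmod_eq_0, Rle_antisym; [|apply Cmod_ge_0].
destruct (nested_limit (fun n => bxa (nested n)) (fun n => bxb (nested n)))
  as [x Hx]; [apply nested_sub|apply nested_sub|].
destruct (nested_limit (fun n => bxc (nested n)) (fun n => bxd (nested n)))
  as [y Hy]; [apply nested_sub|apply nested_sub|].
assert (Hp : in_rect a b c d (x, y)).
{ specialize (Hx 0%nat); specialize (Hy 0%nat); simpl in Hx, Hy.
  unfold in_rect; simpl; lra. }
destruct (Hg _ Hp) as [l [phi [H1 [H2 H3]]]].
set (D := b - a + (d - c)); assert (HD : 0 <= D) by (unfold D; lra).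
apply le_epsilon; intros eps He; rewrite Rplus_0_l.
(* At stage [n] the half perimeter is [D / 2 ^ n] and the deviation from the tangent map is at most
   [e * (D / 2 ^ n)], so the integral is at most [2 * D ^ 2 * e / 4 ^ n]. The powers of [4] cancel
   against the loss in the bisection; the [+ 1] covers [D = 0]. *)
set (e := eps / (2 * D ^ 2 + 1)).
assert (He' : 0 < e) by (apply Rdiv_lt_0_compat; nra).
destruct (Ccont_ball phi (x, y) e H3 He') as [de [Hde Hphi]].
assert (Hn : exists n, D / 2 ^ n < de).
{ destruct (Pow_x_infinity 2 ltac:(rewrite Rabs_pos_eq; lra) (D / de + 1))
    as [n Hn].
  exists n; specialize (Hn n (Nat.le_refl n)).
  assert (Hp2 : 0 < 2 ^ n) by (apply pow_lt; lra).
  rewrite Rabs_pos_eq in Hn by lra.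
  apply Rmult_lt_reg_r with (2 ^ n); auto.
  unfold Rdiv; rewrite Rmult_assoc, Rinv_l, Rmult_1_r by lra.
  assert (D / de < 2 ^ n) by lra.
  apply Rmult_lt_compat_r with (r := de) in H; auto.
  unfold Rdiv in H; rewrite Rmult_assoc, Rinv_l in H; lra. }
destruct Hn as [n Hn].
destruct (nested_spec n) as (S1&S2&S3&S4&S5&S6&S7).
specialize (Hx n); specialize (Hy n); simpl in Hx, Hy.
set (r := nested n) in *.
assert (Hp2 : 0 < 2 ^ n) by (apply pow_lt; lra).
assert (Hw : bxb r - bxa r + (bxd r - bxc r) = D / 2 ^ n)
  by (rewrite S5, S6; unfold D; field; lra).
set (p := (x, y) : C) in *.
set (A := (g p - l * p)%C).
assert (Hc : edge_cont g (bxa r) (bxb r) (bxc r) (bxd r))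
  by (apply (diff_edge_cont g a b c d); auto).
assert (Hca : edge_cont (fun z => A + l * z)%C (bxa r) (bxb r) (bxc r) (bxd r)).
{ intros z _; apply Clim_plus; [apply Clim_const|].
  apply Clim_mult; [apply Clim_const|apply Clim_id]. }
(* Subtracting the tangent map at [p] leaves [(phi z - phi p) * (z - p)], which is of smaller order
   than the size of the box. *)
assert (E : rect_int g (bxa r) (bxb r) (bxc r) (bxd r) =
  rect_int (fun z => g z - (A + l * z))%C (bxa r) (bxb r) (bxc r) (bxd r)).
{ rewrite rect_int_minus, rect_int_affine by (auto; lra); ring. }
assert (HB : box_int g r <= 2 * (D / 2 ^ n) * (e * (D / 2 ^ n))).
{ unfold box_int; rewrite E, <- Hw.
  apply rect_int_bound; try lra; [now apply edge_cont_minus|].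
  intros z [[Hz1 Hz2] _].
  assert (Hzp : Cmod (z - p) <= D / 2 ^ n).
  { eapply Rle_trans; [apply Cmod_le_Re_Im|]; rewrite <- Hw.
    apply Rplus_le_compat; apply Rabs_le; simpl; unfold Re, Im in *; lra. }
  replace (g z - (A + l * z))%C with ((phi z - phi p) * (z - p))%C
    by (rewrite (H1 z), H2; unfold A; ring).
  rewrite Cmod_mult, Hw; apply Rmult_le_compat; auto using Cmod_ge_0.
  apply Rlt_le, Hphi; lra. }
assert (Hp4 : 4 ^ n = 2 ^ n * 2 ^ n)
  by (rewrite <- Rpow_mult_distr; f_equal; lra).
assert (F : box_int g (Box a b c d) / 4 ^ n <= 2 * D ^ 2 * e / 4 ^ n).
{ replace (2 * D ^ 2 * e / 4 ^ n) with (2 * (D / 2 ^ n) * (e * (D / 2 ^ n)))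
    by (rewrite Hp4; field; lra); lra. }
apply Rmult_le_reg_r in F; [|apply Rinv_0_lt_compat, pow_lt; lra].
unfold box_int in F; simpl in F.
eapply Rle_trans; [exact F|].
assert (Ee : e * (2 * D ^ 2 + 1) = eps) by (unfold e; field; nra).
simpl in *; nra.
Qed.

End Goursat.

(** * Residues at real simple poles *)

(** The primitive [2 * atan ((t - p) / s)] runs from [- PI / 2] to [PI / 2]. Each pair of opposite
    sides of a square centred at a pole leads to this integral. *)
Lemma CInt_arctan (A : C) (p s : R) : 0 < s ->
  CInt (fun t => A * RtoC (2 * s / ((t - p) ^ 2 + s ^ 2)))%C (p - s) (p + s) =
  (A * RtoC PI)%C.
Proof.
intros Hs.
assert (Hpos : forall t, 0 < (t - p) ^ 2 + s ^ 2)
  by (intros t; generalize (pow2_ge_0 (t - p)); nra).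
assert (H : is_RInt (fun t => 2 * s / ((t - p) ^ 2 + s ^ 2)) (p - s) (p + s) PI).
{ replace PI with (2 * atan ((p + s - p) / s) - 2 * atan ((p - s - p) / s)).
  - apply (is_RInt_derive (V := R_CompleteNormedModule)
      (fun t => 2 * atan ((t - p) / s))).
    + intros t _; assert (Hp := Hpos t); auto_derive; [lra|].
      field; split; [simpl in Hp |- *; nra|lra].
    + intros t _; assert (Hp := Hpos t).
      apply (ex_derive_continuous (fun t => 2 * s / ((t - p) ^ 2 + s ^ 2))).
      auto_derive; simpl in *; lra.
  - replace ((p + s - p) / s) with 1 by (field; lra).
    replace ((p - s - p) / s) with (- (1)) by (field; lra).
    rewrite atan_opp, atan_1; field. }
assert (K : forall k, RInt (fun t => k * (2 * s / ((t - p) ^ 2 + s ^ 2)))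
  (p - s) (p + s) = k * PI).
{ intros k; apply is_RInt_unique, (is_RInt_scal (V := R_NormedModule)), H. }
unfold CInt; apply Ceq; simpl.
- transitivity (Re A * PI); [|unfold Re; ring].
  rewrite <- K; apply RInt_ext; intros; unfold Re; simpl; ring.
- transitivity (Im A * PI); [|unfold Im; ring].
  rewrite <- K; apply RInt_ext; intros; unfold Im; simpl; ring.
Qed.

Lemma pole_neq (z : C) (p : R) : z <> RtoC p -> (z - RtoC p)%C <> 0.
Proof. intros H H0; apply H, Ceq_minus, H0. Qed.

Lemma pole_cont (k : C) (p : R) (z : C) : z <> RtoC p ->
  Ccont (fun w => k / (w - RtoC p))%C z.
Proof.
intros Hz; apply Cdiff_cont, Cdiff_div; [now apply pole_neq|apply Cdiff_const|].
apply Cdiff_minus; [apply Cdiff_id|apply Cdiff_const].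
Qed.

(** On opposite sides the values of [k / (z - p)] combine into a multiple of
    [2 * s / (t ^ 2 + s ^ 2)], with [t] measured from the centre; each of the two pairs then
    contributes [PI * Ci * k], and no logarithm is involved. *)
Lemma rect_int_pole (k : C) (p s : R) : 0 < s ->
  rect_int (fun z => k / (z - RtoC p))%C (p - s) (p + s) (- s) s =
  (2 * RtoC PI * Ci * k)%C.
Proof.
intros Hs; unfold rect_int.
assert (Hne : forall z, Re z <> p \/ Im z <> 0 -> z <> RtoC p)
  by (intros z Hz ->; simpl in Hz; lra).
rewrite <- CInt_minus by
  (apply (Cint_able_horizontal (fun z => k / (z - RtoC p))%C); [lra|];
   intros; apply pole_cont, Hne; simpl; lra).
rewrite <- CInt_minus by
  (apply (Cint_able_vertical (fun z => k / (z - RtoC p))%C); [lra|];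
   intros; apply pole_cont, Hne; simpl; lra).
assert (Hpos : forall t, 0 < t ^ 2 + s ^ 2)
  by (intros t; generalize (pow2_ge_0 t); nra).
rewrite (CInt_ext _ (fun t => (k * Ci) * RtoC (2 * s / ((t - p) ^ 2 + s ^ 2)))%C);
  [|lra|].
2: { intros t _; assert (Hp := Hpos (t - p)); rewrite RtoC_div by lra.
  set (z1 := (t, - s) : C); set (z2 := (t, s) : C).
  assert (H1 : (z1 - RtoC p)%C <> 0) by (apply pole_neq, Hne; simpl; lra).
  assert (H2 : (z2 - RtoC p)%C <> 0) by (apply pole_neq, Hne; simpl; lra).
  assert (E : RtoC ((t - p) ^ 2 + s ^ 2) =
    ((z1 - RtoC p) * (z2 - RtoC p))%C) by (apply Ceq; simpl; ring).
  assert (E' : RtoC (2 * s) = (- Ci * (z2 - z1))%C) by (apply Ceq; simpl; ring).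
  rewrite E, E'.
  assert (Ci2 : (Ci * Ci = - (1))%C) by (apply Ceq; simpl; ring).
  transitivity (- (Ci * Ci) * k * (z2 - z1) /
    ((z1 - RtoC p) * (z2 - RtoC p)))%C; [|field; auto].
  rewrite Ci2; field; auto. }
rewrite (CInt_ext _ (fun t => k * RtoC (2 * s / ((t - 0) ^ 2 + s ^ 2)))%C (- s) s);
  [|lra|].
2: { intros t _; rewrite Rminus_0_r; assert (Hp := Hpos t).
  rewrite RtoC_div by lra.
  set (z1 := (p + s, t) : C); set (z2 := (p - s, t) : C).
  assert (H1 : (z1 - RtoC p)%C <> 0) by (apply pole_neq, Hne; simpl; lra).
  assert (H2 : (z2 - RtoC p)%C <> 0) by (apply pole_neq, Hne; simpl; lra).
  assert (E : RtoC (t ^ 2 + s ^ 2) =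
    (- (z1 - RtoC p) * (z2 - RtoC p))%C) by (apply Ceq; simpl; ring).
  assert (E' : RtoC (2 * s) = (z1 - z2)%C) by (apply Ceq; simpl; ring).
  rewrite E, E'; field; auto. }
rewrite CInt_arctan by exact Hs.
assert (E0 := CInt_arctan k 0 s Hs); rewrite Rminus_0_l, Rplus_0_l in E0.
rewrite E0; ring.
Qed.

(** Subtracting the pure pole leaves [((z - p) * g z - r) / (z - p)], at most [eps / s] on the
    boundary because [Cmod (z - p)] is at least [s] there; the perimeter is [8 * s]. *)
Lemma square_residue (g : C -> C) (p s eps : R) (r : C) : 0 < s ->
  edge_cont g (p - s) (p + s) (- s) s ->
  (forall z, z <> RtoC p -> Cmod (z - RtoC p) <= 2 * s ->
     Cmod ((z - RtoC p) * g z - r) < eps) ->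
  Cmod (rect_int g (p - s) (p + s) (- s) s - 2 * RtoC PI * Ci * r) <= 8 * eps.
Proof.
intros Hs Hg Hr.
rewrite <- (rect_int_pole r p s Hs).
assert (Hne : forall z, on_edge (p - s) (p + s) (- s) s z -> z <> RtoC p)
  by (intros z [_ Hz] ->; simpl in Hz; lra).
rewrite <- rect_int_minus by
  first [lra | exact Hg | intros z Hz; now apply pole_cont, Hne].
replace (8 * eps) with (2 * (p + s - (p - s) + (s - - s)) * (eps / s))
  by (field; lra).
apply rect_int_bound; try lra.
{ apply edge_cont_minus; auto; intros z Hz; now apply pole_cont, Hne. }
intros z Hz; assert (Hzp := Hne z Hz); assert (Hz0 := pole_neq z p Hzp).
destruct Hz as [[Hz1 Hz2] Hz3].
assert (L1 : Cmod (z - RtoC p) <= 2 * s).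
{ eapply Rle_trans; [apply Cmod_le_Re_Im|].
  replace (2 * s) with (s + s) by ring.
  apply Rplus_le_compat; apply Rabs_le; simpl; unfold Re, Im in *; lra. }
assert (L2 : s <= Cmod (z - RtoC p)).
{ assert (H1 := re_le_Cmod (z - RtoC p)); assert (H2 := im_le_Cmod (z - RtoC p)).
  simpl in H1, H2; fold (Re z) in H1; fold (Im z) in H2.
  apply Rabs_le_between in H1; apply Rabs_le_between in H2.
  destruct Hz3 as [E|[E|[E|E]]]; rewrite E in *; lra. }
replace (g z - r / (z - RtoC p))%C with
  (((z - RtoC p) * g z - r) / (z - RtoC p))%C by (field; auto).
rewrite Cmod_div by auto.
apply Rmult_le_compat; auto using Cmod_ge_0.
- apply Rlt_le, Rinv_0_lt_compat; lra.
- apply Rlt_le, Hr; auto.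
- apply Rinv_le_contravar; auto.
Qed.

Lemma residue_simple_pole (g : C -> C) (a b c d p : R) (r : C) :
  a < p < b -> c < 0 < d ->
  (forall z, in_rect a b c d z -> z <> RtoC p -> Cdiff g z) ->
  Clim (fun z => (z - RtoC p) * g z)%C (RtoC p) r ->
  rect_int g a b c d = (2 * RtoC PI * Ci * r)%C.
Proof.
intros Hp Hcd Hg Hr; apply Ceq_minus, Cmod_eq_0, Rle_antisym; [|apply Cmod_ge_0].
apply le_epsilon; intros eps He; rewrite Rplus_0_l.
destruct (Hr (eps / 8)) as [de [Hde H]]; [lra|].
(* The square must lie strictly inside the rectangle, and its points, at distance at most [2 * s]
   from [p], must lie within [de]. *)
set (s := Rmin (Rmin ((p - a) / 2) ((b - p) / 2))
            (Rmin (Rmin (- c / 2) (d / 2)) (de / 3))).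
assert (Hs : 0 < s) by (repeat apply Rmin_glb_lt; lra).
assert (Hs1 : s <= (p - a) / 2)
  by (eapply Rle_trans; [apply Rmin_l|apply Rmin_l]).
assert (Hs2 : s <= (b - p) / 2)
  by (eapply Rle_trans; [apply Rmin_l|apply Rmin_r]).
assert (Hs3 : s <= - c / 2)
  by (eapply Rle_trans; [apply Rmin_r|]; eapply Rle_trans; apply Rmin_l).
assert (Hs4 : s <= d / 2)
  by (eapply Rle_trans; [apply Rmin_r|];
      eapply Rle_trans; [apply Rmin_l|apply Rmin_r]).
assert (Hs5 : s <= de / 3)
  by (eapply Rle_trans; [apply Rmin_r|apply Rmin_r]).
assert (Hc : forall a' b' c' d', a <= a' -> b' <= b -> c <= c' -> d' <= d ->
  p < a' \/ b' < p \/ a' < p < b' -> c' < 0 < d' \/ 0 < c' \/ d' < 0 ->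
  edge_cont g a' b' c' d').
{ intros a' b' c' d' H1 H2 H3 H4 H5 H6 z [[Hz1 Hz2] Hz3]; apply Cdiff_cont, Hg.
  - unfold in_rect; lra.
  - intros E; rewrite E in *; simpl in *; lra. }
assert (G0 : forall a' b' c' d', a' <= b' -> c' <= d' ->
  a <= a' -> b' <= b -> c <= c' -> d' <= d ->
  p < a' \/ b' < p \/ 0 < c' \/ d' < 0 -> rect_int g a' b' c' d' = 0).
{ intros a' b' c' d' W1 W2 H1 H2 H3 H4 H5; apply Goursat_rectangle; auto.
  intros z [Hz1 Hz2]; apply Hg; [unfold in_rect; lra|].
  intros E; rewrite E in *; simpl in *; lra. }
(* Four cuts leave the square around [p] and four rectangles free of the pole, on which Goursat's
   theorem gives zero. *)
rewrite (rect_int_split_v g a (p - s) b) by (try apply Hc; lra).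
rewrite (rect_int_split_v g (p - s) (p + s) b) by (try apply Hc; lra).
rewrite (rect_int_split_h g (p - s) (p + s) c (- s) d) by (try apply Hc; lra).
rewrite (rect_int_split_h g (p - s) (p + s) (- s) s d) by (try apply Hc; lra).
rewrite (G0 a (p - s)), (G0 (p + s) b), (G0 (p - s) (p + s) c (- s)),
  (G0 (p - s) (p + s) s d) by lra.
rewrite !Cplus_0_l, !Cplus_0_r.
replace eps with (8 * (eps / 8)) by field.
apply square_residue; auto; [apply Hc; lra|].
intros z Hz1 Hz2; apply H; auto; lra.
Qed.

(** Poles outside the open interval are listed but count for zero, so the same list serves every
    subrectangle when the rectangle is cut. *)
Definition residue_sum (r : R -> C) (a b : R) (P : list R) : C :=
  fold_right (fun p acc =>
    (if Rlt_dec a p then if Rlt_dec p b then r p else 0 else 0) + acc)%C 0 P.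

Lemma residue_sum_split (r : R -> C) (a b p s : R) (P : list R) :
  0 < s -> a < p - s -> p + s < b ->
  (forall q, In q P -> s < Rabs (q - p)) ->
  residue_sum r a b P =
  (residue_sum r a (p - s) P + residue_sum r (p + s) b P)%C.
Proof.
intros Hs H1 H2; induction P as [|q P IH]; intros H; simpl; [ring|].
rewrite IH by (intros q' Hq'; apply H; now right).
assert (Hq := H q (or_introl eq_refl)).
unfold Rabs in Hq; destruct (Rcase_abs (q - p)) as [Hc|Hc];
destruct (Rlt_dec a q), (Rlt_dec q b), (Rlt_dec q (p - s)), (Rlt_dec (p + s) q);
  try lra; ring.
Qed.

Lemma isolated_point (p : R) (P : list R) : ~ In p P ->
  exists s, 0 < s /\ forall q, In q P -> s < Rabs (q - p).
Proof.
induction P as [|q P IH]; intros H.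
- exists 1; split; [lra|]; intros q [].
- destruct IH as [s [Hs IH]]; [intros H'; apply H; now right|].
  assert (Hq : 0 < Rabs (q - p))
    by (apply Rabs_pos_lt; intros E; apply H; left; lra).
  exists (Rmin s (Rabs (q - p) / 2)); split; [apply Rmin_glb_lt; lra|].
  intros q' [<-|Hq'].
  + eapply Rle_lt_trans; [apply Rmin_r|lra].
  + eapply Rle_lt_trans; [apply Rmin_l|auto].
Qed.

(** Induction on the list with the interval left general: vertical cuts at [p - s] and [p + s]
    isolate the head [p], and the two outer rectangles involve only the tail. Vertical cuts suffice
    because all poles are real. *)
Theorem residue_theorem_rectangle (c d : R) (g : C -> C) (r : R -> C)
  (P : list R) : c < 0 < d -> NoDup P -> forall a b, a <= b ->
  ~ In a P -> ~ In b P ->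
  (forall z, in_rect a b c d z -> (forall p, In p P -> z <> RtoC p) ->
     Cdiff g z) ->
  (forall p, In p P -> a < p < b ->
     Clim (fun z => (z - RtoC p) * g z)%C (RtoC p) (r p)) ->
  rect_int g a b c d = (2 * RtoC PI * Ci * residue_sum r a b P)%C.
Proof.
intros Hcd; induction P as [|p P IH]; intros HP a b Hab Ha Hb Hg Hr.
{ simpl; rewrite Cmult_0_r; apply Goursat_rectangle; [exact Hab|lra|].
  intros z Hz; apply Hg; auto; intros p []. }
apply NoDup_cons_iff in HP; destruct HP as [Hp HP].
assert (IH' : forall a' b', a <= a' -> a' <= b' -> b' <= b ->
  p < a' \/ b' < p -> ~ In a' P -> ~ In b' P ->
  rect_int g a' b' c d = (2 * RtoC PI * Ci * residue_sum r a' b' P)%C).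
{ intros a' b' H1 H2 H3 H4 Ha' Hb'; apply IH; auto.
  - intros z [Hz1 Hz2] Hz; apply Hg; [unfold in_rect; lra|].
    intros q [<-|Hq]; [|now apply Hz].
    intros ->; simpl in Hz1; lra.
  - intros q Hq Hq'; apply Hr; [now right|lra]. }
simpl.
assert (Hap : a <> p) by (intros E; apply Ha; now left).
assert (Hbp : b <> p) by (intros E; apply Hb; now left).
assert (HaP : ~ In a P) by (intros E; apply Ha; now right).
assert (HbP : ~ In b P) by (intros E; apply Hb; now right).
destruct (Rlt_dec a p) as [H1|H1].
2: { rewrite IH' by (auto; lra); ring. }
destruct (Rlt_dec p b) as [H2|H2].
2: { rewrite IH' by (auto; lra); ring. }
destruct (isolated_point p P Hp) as [s0 [Hs0 Hiso0]].
set (s := Rmin s0 (Rmin ((p - a) / 2) ((b - p) / 2))).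
assert (Hs : 0 < s) by (repeat apply Rmin_glb_lt; lra).
assert (Hs1 : s <= (p - a) / 2)
  by (eapply Rle_trans; [apply Rmin_r|apply Rmin_l]).
assert (Hs2 : s <= (b - p) / 2)
  by (eapply Rle_trans; [apply Rmin_r|apply Rmin_r]).
assert (Hiso : forall q, In q P -> s < Rabs (q - p))
  by (intros q Hq; eapply Rle_lt_trans; [apply Rmin_l|auto]).
assert (Hm : ~ In (p - s) P).
{ intros E; apply Hiso in E; replace (p - s - p) with (- s) in E by ring.
  rewrite Rabs_Ropp, Rabs_pos_eq in E; lra. }
assert (Hm' : ~ In (p + s) P).
{ intros E; apply Hiso in E; replace (p + s - p) with s in E by ring.
  rewrite Rabs_pos_eq in E; lra. }
assert (Hnear : forall q, In q P -> p - s <= q <= p + s -> False).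
{ intros q Hq E; apply Hiso in Hq; revert Hq; apply Rle_not_lt, Rabs_le; lra. }
assert (Hedge : forall a' b', a <= a' -> b' <= b ->
  ~ In a' (p :: P) -> ~ In b' (p :: P) -> edge_cont g a' b' c d).
{ intros a' b' W1 W2 W3 W4 z [[Hz1 Hz2] Hz3]; apply Cdiff_cont, Hg.
  - unfold in_rect; lra.
  - intros q Hq ->; simpl in Hz3.
    destruct Hz3 as [E|[E|[E|E]]]; [rewrite E in Hq; auto|rewrite E in Hq; auto| |];
      lra. }
assert (Nm : ~ In (p - s) (p :: P)) by (intros [E|E]; [lra|auto]).
assert (Nm' : ~ In (p + s) (p :: P)) by (intros [E|E]; [lra|auto]).
rewrite (rect_int_split_v g a (p - s) b) by (try apply Hedge; auto; lra).
rewrite (rect_int_split_v g (p - s) (p + s) b) by (try apply Hedge; auto; lra).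
rewrite (IH' a (p - s)), (IH' (p + s) b) by (auto; lra).
rewrite (residue_simple_pole g (p - s) (p + s) c d p (r p)); try lra.
- rewrite (residue_sum_split r a b p s) by (auto; lra); ring.
- intros z [Hz1 Hz2] Hz; apply Hg; [unfold in_rect; lra|].
  intros q [<-|Hq]; auto; intros ->; simpl in Hz1; now apply (Hnear q).
- apply Hr; [now left|lra].
Qed.

(** * The discretization error *)

Lemma sinh_opp (u : R) : sinh (- u) = - sinh u.
Proof. unfold sinh; rewrite Ropp_involutive; field. Qed.

Lemma exp_le (a b : R) : a <= b -> exp a <= exp b.
Proof. intros [H|H]; [left; now apply exp_increasing|right; now rewrite H]. Qed.

(* [i sin (PI z / h)], whose zeros are the sampling points [k h]. *)
Definition sampler (h : R) (z : C) : C := Csinh (Ci * RtoC (PI / h) * z)%C.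

Lemma sampler_arg (h : R) (z : C) :
  (Ci * RtoC (PI / h) * z)%C = (- (PI / h * Im z), PI / h * Re z).
Proof. apply Ceq; unfold Re, Im; simpl; ring. Qed.

Lemma Cmod_sampler_sqr (h : R) (z : C) : Cmod (sampler h z) ^ 2 =
  sinh (PI / h * Im z) ^ 2 + sin (PI / h * Re z) ^ 2.
Proof.
unfold sampler; rewrite sampler_arg, Cmod_Csinh_sqr, sinh_opp; ring.
Qed.

Lemma sampler_RtoC (h x : R) : sampler h (RtoC x) = (Ci * RtoC (sin (PI / h * x)))%C.
Proof.
unfold sampler; rewrite sampler_arg, Csinh_eq; simpl.
rewrite Rmult_0_r, Ropp_0, sinh_0, cosh_0; apply Ceq; simpl; ring.
Qed.

Lemma Cderiv_sampler (h : R) (z : C) : Cderiv (sampler h) z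
  (Ccosh (Ci * RtoC (PI / h) * z) * (Ci * RtoC (PI / h)))%C.
Proof.
apply (Cderiv_comp Csinh (fun w => Ci * RtoC (PI / h) * w)%C);
  [apply Cderiv_Csinh|].
assert (H := Cderiv_scal (Ci * RtoC (PI / h)) _ z _ (Cderiv_id z)).
now rewrite Cmult_1_r in H.
Qed.

Lemma Cderiv_sampler_R (h p : R) : Cderiv (sampler h) (RtoC p)
  (Ci * RtoC (PI / h * cos (PI / h * p)))%C.
Proof.
replace (Ci * RtoC (PI / h * cos (PI / h * p)))%C with
  (Ccosh (Ci * RtoC (PI / h) * RtoC p) * (Ci * RtoC (PI / h)))%C;
  [apply Cderiv_sampler|].
rewrite sampler_arg, Ccosh_eq; simpl.
rewrite Rmult_0_r, Ropp_0, sinh_0, cosh_0; apply Ceq; simpl; ring.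
Qed.

Lemma sinh_eq_0 (u : R) : sinh u = 0 -> u = 0.
Proof.
intros H; rewrite <- (arcsinh_sinh u), H; apply arcsinh_0.
Qed.

Lemma sampler_zero (h : R) (z : C) : 0 < h -> sampler h z = 0 ->
  exists k : Z, z = RtoC (IZR k * h).
Proof.
intros Hh H; assert (E := Cmod_sampler_sqr h z); rewrite H, Cmod_0 in E.
assert (HP := PI_RGT_0).
assert (Hph : 0 < PI / h) by (apply Rdiv_lt_0_compat; lra).
assert (E1 := pow2_ge_0 (sinh (PI / h * Im z))).
assert (E2 := pow2_ge_0 (sin (PI / h * Re z))).
assert (E3 : sinh (PI / h * Im z) = 0)
  by (apply Rsqr_0_uniq; unfold Rsqr; simpl in *; lra).
assert (E4 : sin (PI / h * Re z) = 0)
  by (apply Rsqr_0_uniq; unfold Rsqr; simpl in *; lra).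
apply sinh_eq_0 in E3; apply sin_eq_0_0 in E4; destruct E4 as [k E4].
exists k; apply Ceq; simpl.
- apply Rmult_eq_reg_l with (PI / h); [|lra]; rewrite E4; field; lra.
- apply Rmult_integral in E3; lra.
Qed.

Lemma sin_Zpi (k : Z) : sin (IZR k * PI) = 0.
Proof. apply sin_eq_0_1; now exists k. Qed.

Lemma cos_Zpi_sqr (k : Z) : cos (IZR k * PI) * cos (IZR k * PI) = 1.
Proof.
generalize (sin2_cos2 (IZR k * PI)); rewrite sin_Zpi; unfold Rsqr; lra.
Qed.

Lemma sinh_pos (u : R) : 0 < u -> 0 < sinh u.
Proof. intros H; rewrite <- sinh_0; now apply sinh_lt. Qed.

Lemma residue_sum_cons (r : R -> C) (a b p : R) (P : list R) :
  residue_sum r a b (p :: P) =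
  ((if Rlt_dec a p then if Rlt_dec p b then r p else 0 else 0) +
   residue_sum r a b P)%C.
Proof. reflexivity. Qed.

Lemma residue_sum_app (r : R -> C) (a b : R) (P Q : list R) :
  residue_sum r a b (P ++ Q) = (residue_sum r a b P + residue_sum r a b Q)%C.
Proof. induction P as [|p P IH]; simpl; [ring|rewrite IH; ring]. Qed.

Lemma residue_sum_map (r : R -> C) (a b : R) (node : nat -> R) (n : nat) :
  (forall j, (j <= n)%nat -> a < node j < b) ->
  residue_sum r a b (map node (seq 0 (S n))) = sum_n (fun j => r (node j)) n.
Proof.
induction n as [|n IH]; intros H.
- rewrite sum_O; simpl; specialize (H 0%nat (Nat.le_refl _)).
  destruct (Rlt_dec a (node 0%nat)); [|lra].
  destruct (Rlt_dec (node 0%nat) b); [|lra]; ring.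
- rewrite seq_S, map_app, residue_sum_app, sum_Sn, IH by (intros; apply H; lia).
  simpl map; simpl residue_sum; specialize (H (S n) (Nat.le_refl _)).
  destruct (Rlt_dec a (node (S n))); [|lra].
  destruct (Rlt_dec (node (S n)) b); [|lra].
  change plus with Cplus; ring.
Qed.

Lemma RtoC_neq (a b : R) : a <> b -> RtoC a <> RtoC b.
Proof. intros H E; apply H; now injection E. Qed.

Lemma RInt_exp (k c a b : R) : c <> 0 ->
  is_RInt (fun t => k * exp (c * t)) a b (k * (exp (c * b) - exp (c * a)) / c).
Proof.
intros Hc.
replace (k * (exp (c * b) - exp (c * a)) / c) with
  (k * exp (c * b) / c - k * exp (c * a) / c) by (field; auto).
apply (is_RInt_derive (V := R_CompleteNormedModule) (fun t => k * exp (c * t) / c)).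
- intros t _; auto_derive; auto; field; auto.
- intros t _; apply (ex_derive_continuous (fun t => k * exp (c * t))).
  auto_derive; auto.
Qed.

Section Discretization.
Variables (F : C -> C) (d y h x : R) (m : nat).
Hypotheses (Hy : 0 < y < d) (Hh : 0 < h).
Hypothesis HF : forall z, Rabs (Im z) < d -> Cdiff F z.
Hypothesis Hx : forall k : Z, x <> IZR k * h.

(** Halfway between two nodes, where [sin (PI / h * L)] is [1] or [-1]: the vertical sides keep away
    from the zeros of the sampler, with a lower bound independent of [m]. *)
Let L : R := (INR m + / 2) * h.
Hypothesis HL : Rabs x < L.

Definition sinc_kernel (z : C) : C := (F z / ((z - RtoC x) * sampler h z))%C.

Lemma sinc_kernel_diff (z : C) : Rabs (Im z) < d -> z <> RtoC x ->
  (forall k : Z, z <> RtoC (IZR k * h)) -> Cdiff sinc_kernel z.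
Proof.
intros Hz Hzx Hk; apply Cdiff_div; [|now apply HF|].
- apply Cmult_neq_0; [now apply pole_neq|].
  intros E; apply sampler_zero in E; auto; destruct E as [k E]; now apply (Hk k).
- apply Cdiff_mult; [apply Cdiff_minus; [apply Cdiff_id|apply Cdiff_const]|].
  eexists; apply Cderiv_sampler.
Qed.

Let node (j : nat) : R := IZR (- Z.of_nat m + Z.of_nat j) * h.

Lemma node_range (j : nat) : (j <= 2 * m)%nat -> - L < node j < L.
Proof.
intros Hj; unfold node, L; rewrite plus_IZR, opp_IZR, <- !INR_IZR_INZ.
apply le_INR in Hj; rewrite mult_INR in Hj; simpl in Hj.
assert (H := pos_INR j); split; nra.
Qed.

(** Here [Rabs (IZR k) < INR m + 1] forces [k] into [[-m, m]] by integrality; so the listed nodes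
    are all the zeros of the sampler in the rectangle. *)
Lemma node_far (k : Z) (t : R) : - L <= t <= L -> t = IZR k * h ->
  exists j, (j <= 2 * m)%nat /\ t = node j.
Proof.
intros Ht ->; unfold L in Ht.
assert (H1 : IZR k < INR m + 1) by nra.
assert (H2 : - (INR m + 1) < IZR k) by nra.
rewrite INR_IZR_INZ in H1, H2.
rewrite <- plus_IZR in H1, H2; rewrite <- opp_IZR in H2.
apply lt_IZR in H1; apply lt_IZR in H2.
exists (Z.to_nat (k + Z.of_nat m)); split; [lia|].
unfold node; do 2 f_equal; lia.
Qed.

(** On the real axis the sampler is [Ci * sin (PI / h * p)]. Its value appears at [x], where it is
    nonzero, and its derivative at a node, where it has a simple zero. *)
Definition sinc_residue (p : R) : C :=
  if Req_EM_T p x then (F (RtoC x) / (Ci * RtoC (sin (PI / h * x))))%C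
  else (F (RtoC p) /
    (RtoC (p - x) * (Ci * RtoC (PI / h * cos (PI / h * p)))))%C.

Lemma sin_x_neq : sin (PI / h * x) <> 0.
Proof.
intros E; apply sin_eq_0_0 in E; destruct E as [k E]; apply (Hx k).
assert (HP := PI_RGT_0).
apply Rmult_eq_reg_l with (PI / h); [rewrite E; field; lra|].
apply Rgt_not_eq, Rdiv_lt_0_compat; lra.
Qed.

Lemma arg_node (k : Z) : PI / h * (IZR k * h) = IZR k * PI.
Proof. field; lra. Qed.

Lemma cos_node_neq (k : Z) : PI / h * cos (PI / h * (IZR k * h)) <> 0.
Proof.
rewrite arg_node; assert (H := cos_Zpi_sqr k); assert (HP := PI_RGT_0).
assert (Hph : 0 < PI / h) by (apply Rdiv_lt_0_compat; lra).
intros E; apply Rmult_integral in E; destruct E as [E|E]; [lra|].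
rewrite E in H; lra.
Qed.

Lemma sinc_residue_x : Clim (fun z => (z - RtoC x) * sinc_kernel z)%C
  (RtoC x) (sinc_residue x).
Proof.
unfold sinc_residue; destruct (Req_EM_T x x) as [_|]; [|congruence].
rewrite <- sampler_RtoC.
assert (Hs : sampler h (RtoC x) <> 0).
{ rewrite sampler_RtoC; apply Cmult_neq_0; [apply Ci_nz|].
  apply RtoC_neq, sin_x_neq. }
assert (Hc : Ccont (sampler h) (RtoC x))
  by (eapply Cderiv_cont, Cderiv_sampler).
destruct (Clim_nonzero _ _ _ Hs Hc) as [e [He H]].
apply (Clim_ext_loc (fun z => F z / sampler h z)%C _ _ _ e); auto.
- intros z Hn Hz; specialize (H z Hn Hz).
  assert (sampler h z <> 0)
    by (apply Cmod_gt_0; generalize (Cmod_ge_0 (sampler h (RtoC x))); lra).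
  unfold sinc_kernel; field; split; auto; now apply pole_neq.
- apply Clim_mult; [|now apply Clim_inv].
  apply Cdiff_cont, HF; simpl; rewrite Rabs_R0; lra.
Qed.

(** Carathéodory's form factors the sampler as [phi z * (z - p)] exactly, so [z - p] cancels and
    [phi p], the derivative, stays in the denominator. *)
Lemma sinc_residue_node (k : Z) :
  Clim (fun z => (z - RtoC (IZR k * h)) * sinc_kernel z)%C
  (RtoC (IZR k * h)) (sinc_residue (IZR k * h)).
Proof.
unfold sinc_residue; destruct (Req_EM_T (IZR k * h) x) as [E|_];
  [now destruct (Hx k)|].
set (p := IZR k * h).
assert (Hpx : p <> x) by (intros E; now apply (Hx k)).
destruct (Cderiv_sampler_R h p) as [phi [H1 [H2 H3]]].
assert (E0 : sampler h (RtoC p) = 0).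
{ rewrite sampler_RtoC; unfold p; rewrite arg_node, sin_Zpi; ring. }
assert (Hphi : phi (RtoC p) <> 0).
{ rewrite H2; apply Cmult_neq_0; [apply Ci_nz|].
  apply RtoC_neq, cos_node_neq. }
destruct (Clim_nonzero _ _ _ Hphi H3) as [e [He H]].
assert (Hpx' : (RtoC p - RtoC x)%C <> 0)
  by (apply pole_neq; now apply RtoC_neq).
assert (Hl : Clim (fun z => z - RtoC x)%C (RtoC p) (RtoC p - RtoC x)%C)
  by (apply Clim_minus; auto using Clim_id, Clim_const).
destruct (Clim_nonzero _ _ _ Hpx' Hl) as [e' [He' H']].
rewrite <- H2, RtoC_minus.
apply (Clim_ext_loc (fun z => F z / ((z - RtoC x) * phi z))%C _ _ _ (Rmin e e')).
- now apply Rmin_glb_lt.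
- intros z Hn Hz.
  specialize (H z Hn (Rlt_le_trans _ _ _ Hz (Rmin_l _ _))).
  specialize (H' z Hn (Rlt_le_trans _ _ _ Hz (Rmin_r _ _))).
  assert (phi z <> 0)
    by (apply Cmod_gt_0; generalize (Cmod_ge_0 (phi (RtoC p))); lra).
  assert ((z - RtoC x)%C <> 0)
    by (apply Cmod_gt_0; generalize (Cmod_ge_0 (RtoC p - RtoC x)); lra).
  unfold sinc_kernel; rewrite (H1 z), E0, Cplus_0_l.
  field; repeat split; auto; now apply pole_neq.
- apply Clim_mult; [|apply Clim_inv; [now apply Cmult_neq_0|now apply Clim_mult]].
  apply Cdiff_cont, HF; simpl; rewrite Rabs_R0; lra.
Qed.

Lemma sinc_residue_Sinc (k : Z) :
  (Ci * RtoC (sin (PI / h * x)) * sinc_residue (IZR k * h))%C =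
  (- (1) * (F (RtoC (IZR k * h)) * RtoC (Sinc k h x)))%C.
Proof.
unfold sinc_residue, Sinc.
destruct (Req_EM_T (IZR k * h) x) as [E|_]; [now destruct (Hx k)|].
destruct (Req_EM_T x (IZR k * h)) as [E|_]; [now destruct (Hx k)|].
assert (HP := PI_RGT_0).
assert (Hkx := Hx k).
replace (PI * (x / h - IZR k)) with (PI / h * x - IZR k * PI) by (field; lra).
rewrite sin_minus, sin_Zpi, Rmult_0_r, Rminus_0_r, arg_node.
assert (Hc := cos_Zpi_sqr k); set (c := cos (IZR k * PI)) in *.
assert (Hc0 : c <> 0) by (intros E; rewrite E in Hc; lra).
assert (Hd : PI / h * x - IZR k * PI <> 0).
{ intros E; apply Hkx; apply Rmult_eq_reg_l with (PI / h);
    [rewrite arg_node; lra|apply Rgt_not_eq, Rdiv_lt_0_compat; lra]. }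
set (s := sin (PI / h * x)).
replace (s * c / (PI / h * x - IZR k * PI)) with
  (- (s / ((IZR k * h - x) * (PI / h * c)))).
2: { replace (PI / h * x - IZR k * PI) with (- (IZR k * h - x) * (PI / h))
      by (field; lra).
  assert (IZR k * h - x <> 0) by lra.
  (* The sinc value carries the sign [c = cos (k PI)] in its numerator, the residue in its
     denominator; they agree because [c * c = 1]. *)
  replace (s * c) with (s * (c * c) / c) by (field; auto).
  rewrite Hc; field; repeat split; auto; lra. }
assert (Hph : PI / h * c <> 0).
{ intros E; apply Rmult_integral in E; destruct E as [E|E]; auto; revert E.
  apply Rgt_not_eq, Rdiv_lt_0_compat; lra. }
assert (Hkx' : IZR k * h - x <> 0) by lra.
rewrite RtoC_opp, RtoC_div, (RtoC_mult (IZR k * h - x))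
  by (now apply Rmult_integral_contrapositive).
field; repeat split; solve [apply Ci_nz|now apply RtoC_neq].
Qed.

(** The [Ci] of the sampler cancels the one in [2 PI Ci]. Stated without dividing by the sine, the
    identity leaves a factor on the right that is at most [1] in modulus, uniformly in [x]. *)
Lemma sinc_error_contour :
  (2 * RtoC PI * (F (RtoC x) -
    sum_Z (fun k => F (RtoC (IZR k * h)) * RtoC (Sinc k h x))
      (- Z.of_nat m) (Z.of_nat m)))%C =
  (RtoC (sin (PI / h * x)) * rect_int sinc_kernel (- L) L (- y) y)%C.
Proof.
set (P := x :: map node (seq 0 (S (2 * m)))).
assert (HmapZ : forall p, In p (map node (seq 0 (S (2 * m)))) ->
  exists j, (j <= 2 * m)%nat /\ p = node j).
{ intros p Hp; apply in_map_iff in Hp; destruct Hp as [j [<- Hj]].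
  apply in_seq in Hj; exists j; split; [lia|auto]. }
assert (HP : NoDup P).
{ apply NoDup_cons.
  - intros Hp; apply HmapZ in Hp; destruct Hp as [j [_ Hj]].
    now apply (Hx (- Z.of_nat m + Z.of_nat j)).
  - apply FinFun.Injective_map_NoDup; [|apply seq_NoDup].
    intros i j E; unfold node in E; apply Rmult_eq_reg_r in E; [|lra].
    apply eq_IZR in E; lia. }
assert (HPin : forall p, In p P -> - L < p < L).
{ intros p [<-|Hp].
  - apply Rabs_lt_between in HL; lra.
  - apply HmapZ in Hp; destruct Hp as [j [Hj ->]]; now apply node_range. }
assert (HLpos : 0 < L) by (generalize (Rabs_pos x); lra).
rewrite (residue_theorem_rectangle (- y) y sinc_kernel sinc_residue P);
  auto; try lra.
- unfold P; rewrite residue_sum_cons.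
  destruct (Rlt_dec (- L) x) as [_|N]; [|apply Rabs_lt_between in HL; lra].
  destruct (Rlt_dec x L) as [_|N]; [|apply Rabs_lt_between in HL; lra].
  rewrite residue_sum_map by apply node_range.
  assert (E : (Ci * RtoC (sin (PI / h * x)) *
     sum_n (fun j => sinc_residue (node j)) (2 * m))%C =
    (- (1) * sum_Z (fun k => F (RtoC (IZR k * h)) * RtoC (Sinc k h x))%C
      (- Z.of_nat m) (Z.of_nat m))%C).
  { unfold sum_Z.
    replace (Z.to_nat (Z.of_nat m - - Z.of_nat m)) with (2 * m)%nat by lia.
    etransitivity; [symmetry; apply (sum_n_mult_l (K := C_Ring))|].
    etransitivity; [|apply (sum_n_mult_l (K := C_Ring))].
    apply sum_n_ext; intros j; apply sinc_residue_Sinc. }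
  assert (Ex : (Ci * RtoC (sin (PI / h * x)) * sinc_residue x)%C = F (RtoC x)).
  { unfold sinc_residue; destruct (Req_EM_T x x) as [_|]; [|congruence].
    field; split; [apply RtoC_neq, sin_x_neq|apply Ci_nz]. }
  rewrite <- Ex.
  match goal with |- context [sum_Z ?f ?a ?b] =>
    replace (sum_Z f a b) with (- (- (1) * sum_Z f a b))%C by ring end.
  rewrite <- E; ring.
- intros Hp; apply HPin in Hp; lra.
- intros Hp; apply HPin in Hp; lra.
- intros z [Hz1 Hz2] Hz; apply sinc_kernel_diff.
  + apply Rabs_lt_between; lra.
  + apply Hz; now left.
  + intros k E.
    destruct (node_far k (IZR k * h)) as [j [Hj Ej]]; auto.
    { rewrite E in Hz1; exact Hz1. }
    apply (Hz (node j)); [|now rewrite <- Ej].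
    right; apply in_map_iff; exists j; split; auto; apply in_seq; lia.
- intros p [<-|Hp] _; [apply sinc_residue_x|].
  apply HmapZ in Hp; destruct Hp as [j [_ ->]]; apply sinc_residue_node.
Qed.

Variables (alpha beta A1 A2 : R).
Hypotheses (Halpha : 0 < alpha) (Hbeta : 0 < beta).
Hypotheses (HA1 : 0 <= A1) (HA2 : 0 <= A2).
Hypothesis Hpos : forall z, Rabs (Im z) < d -> 0 <= Re z ->
  Cmod (F z) <= A2 * exp (- beta * Re z).
Hypothesis Hneg : forall z, Rabs (Im z) < d -> Re z < 0 ->
  Cmod (F z) <= A1 * exp (alpha * Re z).

(** On the horizontal sides [z - x] has modulus at least [y] and the sampler at least
    [sinh (PI / h * y)]; [kappa] is the inverse of the product. *)
Let kappa : R := / (y * sinh (PI / h * y)).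

Lemma kernel_edge_cont : edge_cont sinc_kernel (- L) L (- y) y.
Proof.
intros z [[Hz1 Hz2] Hz3]; apply Cdiff_cont, sinc_kernel_diff.
- apply Rabs_lt_between; lra.
- intros ->; simpl in *; apply Rabs_lt_between in HL; lra.
- intros k ->; simpl in *.
  destruct (node_far k (IZR k * h)) as [j [Hj Ej]]; auto.
  assert (H := node_range j Hj); lra.
Qed.

Lemma sinc_kernel_horizontal (z : C) : Im z = y \/ Im z = - y ->
  Cmod (sinc_kernel z) <= kappa * Cmod (F z).
Proof.
intros Hz; assert (HP := PI_RGT_0).
assert (Hph : 0 < PI / h) by (apply Rdiv_lt_0_compat; lra).
assert (Hs : 0 < sinh (PI / h * y)) by (apply sinh_pos; nra).
assert (H1 : y <= Cmod (z - RtoC x)).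
{ eapply Rle_trans; [|apply im_le_Cmod]; simpl; fold (Im z).
  unfold Rabs; destruct (Rcase_abs _); lra. }
assert (H2 : sinh (PI / h * y) <= Cmod (sampler h z)).
{ apply Rsqr_incr_0; [|lra|apply Cmod_ge_0].
  rewrite !Rsqr_pow2, Cmod_sampler_sqr.
  assert (E : sinh (PI / h * Im z) ^ 2 = sinh (PI / h * y) ^ 2).
  { destruct Hz as [-> | ->]; auto.
    rewrite Ropp_mult_distr_r_reverse, sinh_opp; ring. }
  rewrite E.
  generalize (pow2_ge_0 (sin (PI / h * Re z))); lra. }
assert (Hm : 0 < y * sinh (PI / h * y)) by (apply Rmult_lt_0_compat; lra).
assert (Hm2 : y * sinh (PI / h * y) <= Cmod ((z - RtoC x) * sampler h z))
  by (rewrite Cmod_mult; apply Rmult_le_compat; lra).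
unfold sinc_kernel; rewrite Cmod_div by (apply Cmod_gt_0; lra).
unfold Rdiv; rewrite Rmult_comm; apply Rmult_le_compat_r; [apply Cmod_ge_0|].
apply Rinv_le_contravar; auto.
Qed.

Lemma kappa_pos : 0 < kappa.
Proof.
apply Rinv_0_lt_compat, Rmult_lt_0_compat; [lra|apply sinh_pos].
apply Rmult_lt_0_compat; [|lra].
apply Rdiv_lt_0_compat; [apply PI_RGT_0|lra].
Qed.

(** The side is split at [0], where the rate of decay changes; the two exponential integrals are at
    most [1 / alpha] and [1 / beta], uniformly in [L]. *)
Lemma horizontal_bound (v : R) : v = y \/ v = - y ->
  Cmod (CInt (fun t => sinc_kernel (t, v)) (- L) L) <=
  kappa * (A1 / alpha + A2 / beta).
Proof.
intros Hv; assert (Hk := kappa_pos).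
assert (HLpos : 0 < L) by (generalize (Rabs_pos x); lra).
assert (Hvd : Rabs v < d) by (apply Rabs_lt_between; lra).
assert (Hc : forall a b, a <= b -> - L <= a -> b <= L ->
  Cint_able (fun t => sinc_kernel (t, v)) a b).
{ intros a b H1 H2 H3; apply Cint_able_horizontal; auto.
  intros t Ht; apply kernel_edge_cont; split; [unfold in_rect|]; simpl; lra. }
rewrite (CInt_Chasles _ (- L) 0 L) by (apply Hc; lra).
eapply Rle_trans; [apply Cmod_triangle|].
rewrite Rmult_plus_distr_l; apply Rplus_le_compat.
- assert (HI := RInt_exp (kappa * A1) alpha (- L) 0 ltac:(lra)).
  apply Rle_trans with (RInt (fun t => kappa * A1 * exp (alpha * t)) (- L) 0).
  + apply CInt_bound; [lra|apply Hc; lra|eexists; exact HI|].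
    intros t Ht; eapply Rle_trans; [apply sinc_kernel_horizontal; exact Hv|].
    rewrite Rmult_assoc; apply Rmult_le_compat_l; [lra|].
    apply (Hneg (t, v)); simpl; lra.
  + rewrite (is_RInt_unique _ _ _ _ HI), Rmult_0_r, exp_0.
    replace (kappa * (A1 / alpha)) with (kappa * A1 * 1 / alpha) by (field; lra).
    apply Rmult_le_compat_r; [apply Rlt_le, Rinv_0_lt_compat; lra|].
    apply Rmult_le_compat_l; [nra|].
    generalize (exp_pos (alpha * - L)); lra.
- assert (HI := RInt_exp (kappa * A2) (- beta) 0 L ltac:(lra)).
  apply Rle_trans with (RInt (fun t => kappa * A2 * exp (- beta * t)) 0 L).
  + apply CInt_bound; [lra|apply Hc; lra|eexists; exact HI|].
    intros t Ht; eapply Rle_trans; [apply sinc_kernel_horizontal; exact Hv|].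
    rewrite Rmult_assoc; apply Rmult_le_compat_l; [lra|].
    apply (Hpos (t, v)); simpl; lra.
  + rewrite (is_RInt_unique _ _ _ _ HI), Rmult_0_r, exp_0.
    replace (kappa * A2 * (exp (- beta * L) - 1) / - beta) with
      (kappa * A2 * (1 - exp (- beta * L)) / beta) by (field; lra).
    replace (kappa * (A2 / beta)) with (kappa * A2 * 1 / beta) by (field; lra).
    apply Rmult_le_compat_r; [apply Rlt_le, Rinv_0_lt_compat; lra|].
    apply Rmult_le_compat_l; [nra|].
    generalize (exp_pos (- beta * L)); lra.
Qed.

Lemma sin_L_sqr : sin (PI / h * L) ^ 2 = 1.
Proof.
replace (PI / h * L) with (IZR (Z.of_nat m) * PI + PI / 2)
  by (unfold L; rewrite <- INR_IZR_INZ; field; lra).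
rewrite sin_plus, cos_PI2, sin_PI2, sin_Zpi.
generalize (cos_Zpi_sqr (Z.of_nat m)); simpl; lra.
Qed.

(** The sampler is at least [1] here, so the crude bound [A1 + A2] for [F] is enough: the factor
    [1 / (z - x)] already makes the integral vanish as [L] grows. *)
Lemma vertical_bound (u : R) : u = L \/ u = - L ->
  Cmod (CInt (fun t => sinc_kernel (u, t)) (- y) y) <=
  2 * y * ((A1 + A2) / (L - Rabs x)).
Proof.
intros Hu.
assert (HLpos : 0 < L) by (generalize (Rabs_pos x); lra).
replace (2 * y) with (y - - y) by ring.
apply CInt_bound_const; [lra| |].
{ apply Cint_able_vertical; [lra|]; intros t Ht.
  apply kernel_edge_cont; split; [unfold in_rect|]; simpl; lra. }
intros t Ht; set (z := (u, t) : C).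
assert (H1 : L - Rabs x <= Cmod (z - RtoC x)).
{ eapply Rle_trans; [|apply re_le_Cmod]; simpl.
  unfold Rabs; destruct (Rcase_abs x), (Rcase_abs (u + - x)); lra. }
assert (H2 : 1 <= Cmod (sampler h z)).
{ apply Rsqr_incr_0; [|lra|apply Cmod_ge_0].
  rewrite !Rsqr_pow2, Cmod_sampler_sqr; simpl Re; simpl Im.
  assert (E : sin (PI / h * u) ^ 2 = 1).
  { destruct Hu as [-> | ->]; [apply sin_L_sqr|].
    rewrite Ropp_mult_distr_r_reverse, sin_neg, <- sin_L_sqr; ring. }
  rewrite E; generalize (pow2_ge_0 (sinh (PI / h * t))); lra. }
assert (H3 : Cmod (F z) <= A1 + A2).
{ assert (Htd : Rabs (Im z) < d) by (apply Rabs_lt_between; simpl; lra).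
  assert (Hexp : forall s, s <= 0 -> 0 < exp s <= 1).
  { intros s Hs; split; [apply exp_pos|].
    rewrite <- exp_0; now apply exp_le. }
  destruct (Rle_lt_dec 0 (Re z)) as [H|H].
  - eapply Rle_trans; [now apply Hpos|].
    assert (E := Hexp (- beta * Re z) ltac:(nra)); nra.
  - eapply Rle_trans; [now apply Hneg|].
    assert (E := Hexp (alpha * Re z) ltac:(nra)); nra. }
assert (Hm : L - Rabs x <= Cmod ((z - RtoC x) * sampler h z))
  by (rewrite Cmod_mult; nra).
unfold sinc_kernel; rewrite Cmod_div by (apply Cmod_gt_0; lra).
apply Rmult_le_compat; [apply Cmod_ge_0| |lra|].
- apply Rlt_le, Rinv_0_lt_compat; lra.
- apply Rinv_le_contravar; lra.
Qed.

Lemma sinc_error_bound :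
  2 * PI * Cmod (F (RtoC x) -
    sum_Z (fun k => F (RtoC (IZR k * h)) * RtoC (Sinc k h x))
      (- Z.of_nat m) (Z.of_nat m))%C <=
  2 * (kappa * (A1 / alpha + A2 / beta)) +
  4 * y * ((A1 + A2) / (L - Rabs x)).
Proof.
assert (HP := PI_RGT_0).
assert (E := f_equal Cmod sinc_error_contour).
rewrite !Cmod_mult, !Cmod_R, !Rabs_pos_eq in E by lra.
rewrite E.
apply Rle_trans with (1 * Cmod (rect_int sinc_kernel (- L) L (- y) y)).
{ apply Rmult_le_compat_r; [apply Cmod_ge_0|].
  apply Rabs_le, SIN_bound. }
rewrite Rmult_1_l; unfold rect_int.
assert (V1 := vertical_bound L (or_introl eq_refl)).
assert (V2 := vertical_bound (- L) (or_intror eq_refl)).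
assert (H1 := horizontal_bound (- y) (or_intror eq_refl)).
assert (H2 := horizontal_bound y (or_introl eq_refl)).
eapply Rle_trans; [apply Cmod_triangle|].
rewrite Cmod_mult, Cmod_Ci.
generalize (Cmod_triangle (CInt (fun t => sinc_kernel (t, (- y))) (- L) L)
              (- CInt (fun t => sinc_kernel (t, y)) (- L) L))
  (Cmod_triangle (CInt (fun t => sinc_kernel (L, t)) (- y) y)
              (- CInt (fun t => sinc_kernel ((- L), t)) (- y) y)).
rewrite !Cmod_opp; unfold Cminus; lra.
Qed.

End Discretization.

(** * Decay and truncation *)

Lemma Cmod_one_plus_Csinh_sqr (d u v : R) : 0 <= d < PI / 2 -> Rabs v <= d ->
  (exp (Rabs u) * cos d / 2) ^ 2 <= Cmod (1 + Csinh (u, v) * Csinh (u, v)).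
Proof.
intros Hd Hv; assert (HP := PI_RGT_0); assert (Hv0 := Rabs_pos v).
rewrite one_plus_Csinh_sqr, Cmod_mult.
replace (Cmod (Ccosh (u, v)) * Cmod (Ccosh (u, v))) with
  (Cmod (Ccosh (u, v)) ^ 2) by ring.
rewrite Ccosh_eq, Cmod2_alt; simpl Re; simpl Im.
assert (Hc : 0 < cos d <= cos v).
{ split; [apply cos_gt_0; lra|].
  replace (cos v) with (cos (Rabs v))
    by (unfold Rabs; destruct (Rcase_abs v); auto using cos_neg).
  apply cos_decr_1; lra. }
assert (Hcosh : exp (Rabs u) / 2 <= cosh u).
{ unfold cosh, Rabs; generalize (exp_pos u) (exp_pos (- u)).
  destruct (Rcase_abs u); lra. }
assert (He := exp_pos (Rabs u)).
assert (H0 := pow2_ge_0 (sinh u * sin v)).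
assert (H1 : exp (Rabs u) * cos d / 2 <= cosh u * cos v)
  by (replace (exp (Rabs u) * cos d / 2) with (exp (Rabs u) / 2 * cos d) by field;
      apply Rmult_le_compat; lra).
assert (H2 : 0 <= exp (Rabs u) * cos d / 2) by nra.
assert (H3 := pow_incr _ _ 2 (conj H2 H1)); lra.
Qed.

(** Taking logarithms makes the comparison linear. The width [d = 0] is allowed on purpose: with
    [v = 0] it gives the sharper bound on the real axis. *)
Lemma decayE1_bound (d gamma u v : R) : 0 <= d < PI / 2 -> 0 < gamma ->
  Rabs v <= d -> Cmod (decayE1 (Csinh (u, v)) gamma) <=
  Rpower 2 gamma / Rpower (cos d) gamma * exp (- gamma * Rabs u).
Proof.
intros Hd Hg Hv; assert (H := Cmod_one_plus_Csinh_sqr d u v Hd Hv).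
assert (Hc : 0 < cos d) by (apply cos_gt_0; lra).
assert (He := exp_pos (Rabs u)).
rewrite Cmod_decayE1.
set (q := exp (Rabs u) * cos d / 2) in *.
assert (Hq : 0 < q) by (unfold q; nra).
assert (Hq2 : 0 < q ^ 2) by nra.
apply ln_le in H; auto.
replace (q ^ 2) with (q * q) in H by ring; rewrite ln_mult in H by auto.
assert (Eq : ln q = Rabs u + ln (cos d) - ln 2).
{ unfold q, Rdiv; rewrite !ln_mult, ln_exp, ln_Rinv; try lra; nra. }
unfold Rpower, Rdiv; rewrite <- exp_Ropp, <- !exp_plus.
set (l := ln (Cmod (1 + Csinh (u, v) * Csinh (u, v)))) in *.
assert (E : - gamma * / 2 * l <= gamma * ln 2 + - (gamma * ln (cos d)) + - gamma * Rabs u)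
  by nra.
now apply exp_le.
Qed.

(** * Values of the sinc functions and tails of sums over integers *)

Lemma Rabs_Sinc_le (k : Z) (h x : R) : Rabs (Sinc k h x) <= 1.
Proof.
unfold Sinc; destruct (Req_EM_T x (IZR k * h)); [rewrite Rabs_R1; lra|].
set (t := PI * (x / h - IZR k)).
(* Nothing is assumed about [h]: for [h = 0] the argument can vanish off the node, and the quotient
   by zero is then [0]. *)
destruct (Req_dec t 0) as [->|Ht].
- rewrite sin_0; unfold Rdiv; rewrite Rmult_0_l, Rabs_R0; lra.
- rewrite Rabs_div by auto.
  assert (H := Rabs_pos_lt t Ht); assert (H1 := Rabs_sin_le t).
  apply Rmult_le_reg_r with (Rabs t); auto.
  unfold Rdiv; rewrite Rmult_assoc, Rinv_l by lra; lra.
Qed.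

Lemma Sinc_node (k j : Z) (h : R) : 0 < h -> k <> j -> Sinc k h (IZR j * h) = 0.
Proof.
intros Hh Hkj; unfold Sinc; destruct (Req_EM_T (IZR j * h) (IZR k * h)) as [E|E].
- apply Rmult_eq_reg_r in E; [|lra]; apply eq_IZR in E; congruence.
- replace (PI * (IZR j * h / h - IZR k)) with (IZR (j - k) * PI)
    by (rewrite minus_IZR; field; lra).
  rewrite sin_Zpi; unfold Rdiv; ring.
Qed.

Lemma sum_Z_last (G : Z -> C) (a b : Z) : (a <= b)%Z ->
  sum_Z G a (b + 1) = (sum_Z G a b + G (b + 1)%Z)%C.
Proof.
intros H; unfold sum_Z.
replace (Z.to_nat (b + 1 - a)) with (S (Z.to_nat (b - a))) by lia.
rewrite sum_Sn.
replace (a + Z.of_nat (S (Z.to_nat (b - a))))%Z with (b + 1)%Z by lia; reflexivity.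
Qed.

Lemma sum_Z_first (G : Z -> C) (a b : Z) : (a <= b)%Z ->
  sum_Z G (a - 1) b = (G (a - 1)%Z + sum_Z G a b)%C.
Proof.
intros H; unfold sum_Z.
replace (Z.to_nat (b - (a - 1))) with (S (Z.to_nat (b - a))) by lia.
unfold sum_n; rewrite sum_Sn_m by lia.
rewrite <- sum_n_m_S.
replace (a - 1 + Z.of_nat 0)%Z with (a - 1)%Z by lia.
change plus with Cplus; f_equal; apply sum_n_m_ext; intros j; f_equal; lia.
Qed.

Lemma sum_Z_single (G : Z -> C) (a b j : Z) : (a <= j <= b)%Z ->
  (forall k, k <> j -> G k = 0) -> sum_Z G a b = G j.
Proof.
intros Hj HG.
assert (H0 : forall q, (q < j - a)%Z -> (0 <= q)%Z -> sum_Z G a (a + q) = 0).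
{ intros q Hq Hq0; revert Hq; pattern q; apply natlike_ind; auto.
  - intros; unfold sum_Z; replace (a + 0 - a)%Z with 0%Z by lia.
    simpl; rewrite sum_O; apply HG; lia.
  - intros p Hp IH Hq; replace (a + Z.succ p)%Z with (a + p + 1)%Z by lia.
    rewrite sum_Z_last, IH, HG by lia; ring. }
assert (H1 : sum_Z G a j = G j).
{ destruct (Z.eq_dec a j) as [->|Hn].
  - unfold sum_Z; rewrite Z.sub_diag; simpl; rewrite sum_O; f_equal; lia.
  - replace j with (a + (j - a - 1) + 1)%Z by lia.
    rewrite sum_Z_last, H0 by lia; ring. }
assert (H2 : forall q, (0 <= q)%Z -> sum_Z G a (j + q) = G j).
{ intros q Hq; pattern q; apply natlike_ind; auto.
  - now rewrite Z.add_0_r.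
  - intros p Hp IH; replace (j + Z.succ p)%Z with (j + p + 1)%Z by lia.
    rewrite sum_Z_last, IH, (HG (j + p + 1)%Z) by lia; ring. }
replace b with (j + (b - j))%Z by lia; apply H2; lia.
Qed.

(** Telescoping: when each term is dominated by a decrement of [u], the tail is bounded by a
    difference of two values of [u], and no series has to be summed. *)
Lemma sum_Z_tail_right (G : Z -> C) (u : Z -> R) (a b : Z) (q : nat) :
  (a <= b)%Z -> (forall k, (b <= k)%Z -> Cmod (G (k + 1)%Z) <= u k - u (k + 1)%Z) ->
  Cmod (sum_Z G a (b + Z.of_nat q) - sum_Z G a b) <= u b - u (b + Z.of_nat q)%Z.
Proof.
intros Hab Hu; induction q as [|q IH].
- simpl; rewrite Z.add_0_r, Cmod_minus_0; lra.
- replace (b + Z.of_nat (S q))%Z with (b + Z.of_nat q + 1)%Z by lia.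
  rewrite sum_Z_last by lia.
  replace (_ - _)%C with ((sum_Z G a (b + Z.of_nat q) - sum_Z G a b) +
    G (b + Z.of_nat q + 1)%Z)%C by ring.
  eapply Rle_trans; [apply Cmod_triangle|].
  assert (H := Hu (b + Z.of_nat q)%Z ltac:(lia)); lra.
Qed.

Lemma sum_Z_tail_left (G : Z -> C) (u : Z -> R) (a b : Z) (q : nat) :
  (a <= b)%Z -> (forall k, (k <= a)%Z -> Cmod (G (k - 1)%Z) <= u k - u (k - 1)%Z) ->
  Cmod (sum_Z G (a - Z.of_nat q) b - sum_Z G a b) <= u a - u (a - Z.of_nat q)%Z.
Proof.
intros Hab Hu; induction q as [|q IH].
- simpl; rewrite Z.sub_0_r, Cmod_minus_0; lra.
- replace (a - Z.of_nat (S q))%Z with (a - Z.of_nat q - 1)%Z by lia.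
  rewrite sum_Z_first by lia.
  replace (_ - _)%C with ((sum_Z G (a - Z.of_nat q) b - sum_Z G a b) +
    G (a - Z.of_nat q - 1)%Z)%C by ring.
  eapply Rle_trans; [apply Cmod_triangle|].
  assert (H := Hu (a - Z.of_nat q)%Z ltac:(lia)); lra.
Qed.

(** Equivalent to [c <= exp c - 1] up to a nonnegative factor. This comparison of a sum with an
    integral puts [beta * h], rather than [1 - exp (- (beta * h))], in the denominator of the tail
    bound. *)
Lemma exp_telescope (A c t : R) : 0 <= A -> 0 < c ->
  A * exp (- (t + c)) <= A / c * exp (- t) - A / c * exp (- (t + c)).
Proof.
intros HA Hc; assert (HE := exp_pos (- (t + c))).
replace (- t) with (c + - (t + c)) by ring; rewrite exp_plus.
assert (H := exp_ineq1_le c).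
apply Rmult_le_reg_r with c; auto.
replace ((_ - _) * c) with (A * exp (- (t + c)) * (exp c - 1)) by (field; lra).
apply Rmult_le_compat_l; nra.
Qed.

(** * Error of the truncated interpolant *)

Section Error.
Variables (F : C -> C) (d h : R).
Hypotheses (Hd : 0 < d) (Hh : 0 < h).
Hypothesis HF : forall z, Rabs (Im z) < d -> Cdiff F z.
(** [A1] and [A2] bound [F] in the strip and feed the contour integral; [B1] and [B2] bound it on
    the real axis, where the nodes lie, and are smaller in the application. *)
Variables (alpha beta A1 A2 B1 B2 : R).
Hypotheses (Halpha : 0 < alpha) (Hbeta : 0 < beta).
Hypotheses (HA1 : 0 <= A1) (HA2 : 0 <= A2) (HB1 : 0 <= B1) (HB2 : 0 <= B2).
Hypothesis Hpos : forall z, Rabs (Im z) < d -> 0 <= Re z ->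
  Cmod (F z) <= A2 * exp (- beta * Re z).
Hypothesis Hneg : forall z, Rabs (Im z) < d -> Re z < 0 ->
  Cmod (F z) <= A1 * exp (alpha * Re z).
Hypothesis HposR : forall x, 0 <= x -> Cmod (F (RtoC x)) <= B2 * exp (- beta * x).
Hypothesis HnegR : forall x, x < 0 -> Cmod (F (RtoC x)) <= B1 * exp (alpha * x).

Definition sinc_term (x : R) (k : Z) : C :=
  (F (RtoC (IZR k * h)) * RtoC (Sinc k h x))%C.

Definition truncation_bound (M N : Z) : R :=
  B1 / (alpha * h) * exp (- (alpha * IZR M * h)) +
  B2 / (beta * h) * exp (- (beta * IZR N * h)).

Lemma Cmod_sinc_term (x : R) (k : Z) :
  Cmod (sinc_term x k) <= Cmod (F (RtoC (IZR k * h))).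
Proof.
unfold sinc_term; rewrite Cmod_mult, Cmod_R.
generalize (Cmod_ge_0 (F (RtoC (IZR k * h)))) (Rabs_Sinc_le k h x); nra.
Qed.

(** The bound is independent of [m], so it survives the passage to an infinite contour. To the left
    of [- M] the telescoping function is the increasing [exp (alpha * k * h)]. *)
Lemma truncation_error (x : R) (M N : Z) (m : nat) :
  (0 <= M <= Z.of_nat m)%Z -> (0 <= N <= Z.of_nat m)%Z ->
  Cmod (sum_Z (sinc_term x) (- Z.of_nat m) (Z.of_nat m) -
        sum_Z (sinc_term x) (- M) N) <= truncation_bound M N.
Proof.
intros HM HN.
assert (Hah : 0 < alpha * h) by nra; assert (Hbh : 0 < beta * h) by nra.
assert (R1 := sum_Z_tail_right (sinc_term x)
  (fun k => B2 / (beta * h) * exp (- (beta * IZR k * h)))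
  (- Z.of_nat m) N (Z.to_nat (Z.of_nat m - N)) ltac:(lia)).
assert (R2 := sum_Z_tail_left (sinc_term x)
  (fun k => B1 / (alpha * h) * exp (alpha * IZR k * h))
  (- M) N (Z.to_nat (Z.of_nat m - M)) ltac:(lia)).
replace (N + Z.of_nat (Z.to_nat (Z.of_nat m - N)))%Z with (Z.of_nat m) in R1 by lia.
replace (- M - Z.of_nat (Z.to_nat (Z.of_nat m - M)))%Z with (- Z.of_nat m)%Z in R2
  by lia.
simpl in R1, R2.
assert (P1 : 0 <= B2 / (beta * h) * exp (- (beta * IZR (Z.of_nat m) * h))).
{ apply Rmult_le_pos; [apply Rdiv_le_0_compat; lra|apply Rlt_le, exp_pos]. }
assert (P2 : 0 <= B1 / (alpha * h) * exp (alpha * IZR (- Z.of_nat m) * h)).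
{ apply Rmult_le_pos; [apply Rdiv_le_0_compat; lra|apply Rlt_le, exp_pos]. }
unfold truncation_bound.
eapply Rle_trans; [apply (Cmod_triangle_minus _ (sum_Z (sinc_term x) (- Z.of_nat m) N))|].
rewrite Rplus_comm; apply Rplus_le_compat.
- eapply Rle_trans; [apply R2|].
  + intros k Hk; eapply Rle_trans; [apply Cmod_sinc_term|].
    assert (Hk' : IZR (k - 1) < 0) by (apply IZR_lt; lia).
    eapply Rle_trans; [apply HnegR; nra|].
    replace (alpha * (IZR (k - 1) * h)) with (- (- (alpha * IZR k * h) + alpha * h))
      by (rewrite minus_IZR; ring).
    replace (alpha * IZR (k - 1) * h) with (- (- (alpha * IZR k * h) + alpha * h))
      by (rewrite minus_IZR; ring).
    replace (alpha * IZR k * h) with (- - (alpha * IZR k * h)) at 2 by ring.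
    now apply exp_telescope.
  + rewrite opp_IZR.
    replace (alpha * - IZR M * h) with (- (alpha * IZR M * h)) by ring.
    lra.
- eapply Rle_trans; [apply R1|lra].
  intros k Hk; eapply Rle_trans; [apply Cmod_sinc_term|].
  assert (Hk' : 0 <= IZR (k + 1)) by (apply IZR_le; lia).
  eapply Rle_trans; [apply HposR; nra|].
  replace (- beta * (IZR (k + 1) * h)) with (- (beta * IZR k * h + beta * h))
    by (rewrite plus_IZR; ring).
  replace (beta * IZR (k + 1) * h) with (beta * IZR k * h + beta * h)
    by (rewrite plus_IZR; ring).
  now apply exp_telescope.
Qed.

Definition discretization_bound : R :=
  (A1 / alpha + A2 / beta) / (PI * (d * sinh (PI / h * d))).

Lemma discretization_bound_pos : 0 <= discretization_bound.
Proof.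
assert (HP := PI_RGT_0).
apply Rdiv_le_0_compat.
- apply Rplus_le_le_0_compat; apply Rdiv_le_0_compat; auto.
- apply Rmult_lt_0_compat; auto; apply Rmult_lt_0_compat; auto.
  apply sinh_pos, Rmult_lt_0_compat; auto; now apply Rdiv_lt_0_compat.
Qed.

(** The limit of infinitely long contours at fixed height. The denominator is multiplied out so that
    the next limit, [y] tending to [d], needs only continuity. *)
Lemma error_inside (x y : R) (M N : Z) : (0 <= M)%Z -> (0 <= N)%Z ->
  (forall k, x <> IZR k * h) -> 0 < y < d ->
  (Cmod (F (RtoC x) - sum_Z (sinc_term x) (- M) N) - truncation_bound M N) *
  (PI * (y * sinh (PI / h * y))) <= A1 / alpha + A2 / beta.
Proof.
intros HM HN Hx Hy; assert (HP := PI_RGT_0).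
set (e := Cmod _ - _).
assert (Hs : 0 < y * sinh (PI / h * y)).
{ apply Rmult_lt_0_compat; [lra|].
  apply sinh_pos, Rmult_lt_0_compat; [now apply Rdiv_lt_0_compat|lra]. }
set (s := y * sinh (PI / h * y)) in *.
assert (Hlim : 2 * PI * e <= 2 * (/ s * (A1 / alpha + A2 / beta))).
{ apply le_epsilon; intros eps He.
  set (D := 4 * y * (A1 + A2)).
  assert (HD : 0 <= D) by (unfold D; apply Rmult_le_pos; lra).
  destruct (nfloor_ex ((D / eps + Rabs x) / h)) as [m0 [_ Hm0]].
  { apply Rdiv_le_0_compat; auto; apply Rplus_le_le_0_compat; auto using Rabs_pos.
    now apply Rdiv_le_0_compat. }
  (* Large enough for the vertical sides to contribute at most [eps], which amounts to
     [L - Rabs x >= D / eps], and for [[-m, m]] to contain all the nodes kept in the truncated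
     sum. *)
  set (m := (m0 + 1 + Z.to_nat M + Z.to_nat N)%nat).
  assert (Hm : D / eps + Rabs x < (INR m + / 2) * h).
  { apply Rmult_lt_compat_r with (r := h) in Hm0; auto.
    unfold Rdiv in Hm0 at 1; rewrite Rmult_assoc, Rinv_l, Rmult_1_r in Hm0 by lra.
    eapply Rlt_le_trans; [exact Hm0|]; apply Rmult_le_compat_r; [lra|].
    unfold m; rewrite !plus_INR; simpl.
    generalize (pos_INR (Z.to_nat M)) (pos_INR (Z.to_nat N)); lra. }
  assert (HDe : 0 <= D / eps) by (now apply Rdiv_le_0_compat).
  assert (B := sinc_error_bound F d y h x m Hy Hh HF Hx ltac:(lra)
    alpha beta A1 A2 Halpha Hbeta HA1 HA2 Hpos Hneg).
  fold s in B; fold (sinc_term x) in B.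
  assert (T := truncation_error x M N m ltac:(lia) ltac:(lia)).
  assert (E := Cmod_triangle_minus (F (RtoC x))
    (sum_Z (sinc_term x) (- Z.of_nat m) (Z.of_nat m))
    (sum_Z (sinc_term x) (- M) N)).
  assert (Ee : 4 * y * ((A1 + A2) / ((INR m + / 2) * h - Rabs x)) <= eps).
  { replace (4 * y * _) with (D / ((INR m + / 2) * h - Rabs x))
      by (unfold D; field; lra).
    apply Rmult_le_reg_r with ((INR m + / 2) * h - Rabs x); [lra|].
    unfold Rdiv at 1; rewrite Rmult_assoc, Rinv_l, Rmult_1_r by lra.
    apply Rmult_le_reg_r with (/ eps); [now apply Rinv_0_lt_compat|].
    replace (eps * _ * / eps) with ((INR m + / 2) * h - Rabs x) by (field; lra).
    unfold Rdiv in Hm; lra. }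
  unfold sinc_term in B at 1.
  assert (e <= Cmod (F (RtoC x) -
    sum_Z (sinc_term x) (- Z.of_nat m) (Z.of_nat m))) by (unfold e; lra).
  apply Rmult_le_compat_l with (r := 2 * PI) in H; [|lra].
  unfold sinc_term in *; lra. }
apply Rmult_le_compat_r with (r := s / 2) in Hlim; [|lra].
replace (2 * (/ s * (A1 / alpha + A2 / beta)) * (s / 2)) with
  (A1 / alpha + A2 / beta) in Hlim by (field; repeat split; lra).
lra.
Qed.

Theorem sinc_approximation_error (x : R) (M N : Z) : (0 <= M)%Z -> (0 <= N)%Z ->
  Cmod (F (RtoC x) - sum_Z (sinc_term x) (- M) N) <=
  discretization_bound + truncation_bound M N.
Proof.
intros HM HN; assert (HP := PI_RGT_0); assert (HQ := discretization_bound_pos).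
destruct (Classical_Prop.classic (exists k, x = IZR k * h)) as [[j Hj]|Hx].
(* At a node, a sum long enough to contain it reduces to the single term [F x], so the whole error
   is truncation. *)
- set (m := (Z.abs_nat j + Z.to_nat M + Z.to_nat N)%nat).
  assert (T := truncation_error x M N m ltac:(lia) ltac:(lia)).
  rewrite (sum_Z_single _ _ _ j) in T; [|lia|].
  + unfold sinc_term in T at 1; rewrite <- Hj in T.
    assert (E : Sinc j h x = 1)
      by (unfold Sinc; destruct (Req_EM_T x (IZR j * h)); [auto|contradiction]).
    rewrite E, Cmult_1_r in T; lra.
  + intros k Hk; unfold sinc_term; rewrite Hj, Sinc_node by auto; ring.
- assert (Hx' : forall k, x <> IZR k * h) by (intros k E; apply Hx; now exists k).
  set (e := Cmod (F (RtoC x) - sum_Z (sinc_term x) (- M) N)).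
  set (S0 := A1 / alpha + A2 / beta).
  set (psi := fun y => (e - truncation_bound M N) * (PI * (y * sinh (PI / h * y)))).
  assert (Hpsi : psi d <= S0).
  (* If the inequality failed at [d], it would by continuity fail at some [y < d] close to [d]; the
     maximum with [d / 2] below keeps that [y] positive. *)
  { apply Rnot_lt_le; intros L.
    assert (Hc : continuity_pt psi d).
    { apply derivable_continuous_pt, ex_derive_Reals_0.
      unfold psi, sinh; auto_derive; auto. }
    destruct (Hc (psi d - S0)) as [de [Hde H]]; [lra|].
    set (y := Rmax (d / 2) (d - de / 2)).
    assert (Hy1 : d / 2 <= y) by apply Rmax_l.
    assert (Hy2 : d - de / 2 <= y) by apply Rmax_r.
    assert (Hy3 : y < d) by (apply Rmax_lub_lt; lra).
    assert (Hy : psi y <= S0) by (apply error_inside; auto; lra).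
    specialize (H y); simpl in H; unfold R_dist in H.
    assert (Hd' : Rabs (psi y - psi d) < psi d - S0).
    { apply H; split; [split; [exact I|lra]|].
      rewrite Rabs_left; lra. }
    apply Rabs_lt_between in Hd'; lra. }
  unfold psi in Hpsi; unfold discretization_bound.
  assert (Hs : 0 < PI * (d * sinh (PI / h * d))).
  { apply Rmult_lt_0_compat; auto; apply Rmult_lt_0_compat; auto.
    apply sinh_pos, Rmult_lt_0_compat; auto; now apply Rdiv_lt_0_compat. }
  fold S0; apply Rplus_le_reg_r with (- truncation_bound M N).
  set (q := PI * (d * sinh (PI / h * d))) in *.
  replace (S0 / q + truncation_bound M N + - truncation_bound M N) with (S0 / q)
    by ring.
  apply Rmult_le_reg_r with q; auto.
  unfold Rdiv; rewrite Rmult_assoc, Rinv_l, Rmult_1_r by lra; exact Hpsi.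
Qed.

End Error.

(** * The constants *)

Lemma composed_diff (f : C -> C) (d : R) :
  analytic_in f (image Csinh (strip d)) ->
  forall z, Rabs (Im z) < d -> Cdiff (fun w => f (Csinh w)) z.
Proof.
intros Hf z Hz; destruct (ex_derive_Cdiff f (Csinh z)) as [l Hl].
- apply Hf; exists z; split; auto.
- eexists; apply (Cderiv_comp f Csinh); [exact Hl|apply Cderiv_Csinh].
Qed.

(** For a base at most [1] the larger exponent gives the smaller power; hence [nu] is the safe
    exponent of [cos d] in a denominator. *)
Lemma Rpower_le_base_lt_1 (c g nu : R) : 0 < c <= 1 -> g <= nu ->
  Rpower c nu <= Rpower c g.
Proof.
intros Hc Hg; unfold Rpower.
assert (ln c <= 0) by (rewrite <- ln_1; apply ln_le; lra).
assert (E : nu * ln c <= g * ln c) by nra.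
now apply exp_le.
Qed.

Section Constants.
Variables (d K alpha beta mu nu h n sigma : R).
Hypotheses (Hd : 0 < d < PI / 2) (HK : 0 < K) (Hmu : 0 < mu) (Hn : 1 <= n).
Hypotheses (Ha : mu <= alpha <= nu) (Hb : mu <= beta <= nu).
Hypothesis Hh : h = sqrt (PI * d / (mu * n)).
Hypothesis Hsigma : sigma = sqrt (PI * d * mu * n).

Lemma step_pos : 0 < h.
Proof.
rewrite Hh; apply sqrt_lt_R0, Rdiv_lt_0_compat; assert (HP := PI_RGT_0); nra.
Qed.

(** This is the exponent of the discretization error; the next identity, for [mu * n * h], gives
    that of the tails. Their equality is what determines [h]. *)
Lemma step_sigma_d : PI / h * d = sigma.
Proof.
assert (HP := PI_RGT_0); assert (H := step_pos).
assert (Hpd : 0 < PI * d) by nra; assert (Hmn : 0 < mu * n) by nra.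
assert (E : h * h = PI * d / (mu * n))
  by (rewrite Hh; apply sqrt_sqrt, Rlt_le, Rdiv_lt_0_compat; auto).
symmetry; rewrite Hsigma; apply sqrt_lem_1.
- nra.
- apply Rlt_le, Rmult_lt_0_compat; [now apply Rdiv_lt_0_compat|lra].
- replace (PI / h * d * (PI / h * d)) with (PI * d * (PI * d) / (h * h))
    by (field; lra).
  rewrite E; field; repeat split; lra.
Qed.

Lemma step_sigma_mu : mu * n * h = sigma.
Proof.
assert (HP := PI_RGT_0); assert (H := step_pos).
assert (Hpd : 0 < PI * d) by nra; assert (Hmn : 0 < mu * n) by nra.
assert (E : h * h = PI * d / (mu * n))
  by (rewrite Hh; apply sqrt_sqrt, Rlt_le, Rdiv_lt_0_compat; auto).
symmetry; rewrite Hsigma; apply sqrt_lem_1; [nra|nra|].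
replace (mu * n * h * (mu * n * h)) with (mu * n * (mu * n) * (h * h)) by ring.
rewrite E; field; lra.
Qed.

Let s : R := sqrt (PI * d * mu).

Lemma PI_d_mu_pos : 0 < PI * d * mu.
Proof.
assert (HP := PI_RGT_0); apply Rmult_lt_0_compat; auto.
apply Rmult_lt_0_compat; lra.
Qed.

Lemma sqrt_PI_d_mu_pos : 0 < s.
Proof. apply sqrt_lt_R0, PI_d_mu_pos. Qed.

Lemma sqrt_PI_d_mu_sqr : s * s = PI * d * mu.
Proof. apply sqrt_sqrt, Rlt_le, PI_d_mu_pos. Qed.

Lemma sigma_s : sigma = s * sqrt n.
Proof. rewrite Hsigma; apply sqrt_mult; [apply Rlt_le, PI_d_mu_pos|lra]. Qed.

Lemma sqrt_n_ge_1 : 1 <= sqrt n.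
Proof. rewrite <- sqrt_1; apply sqrt_le_1; lra. Qed.

(** Each tail is at most [K * Rpower 2 nu / (mu * h) * exp (- sigma)]; adding the two raises the
    exponent of [2] from [nu] to [nu + 1]. *)
Lemma truncation_le (M N : R) : mu * n <= alpha * M -> mu * n <= beta * N ->
  K * Rpower 2 alpha / (alpha * h) * exp (- (alpha * M * h)) +
  K * Rpower 2 beta / (beta * h) * exp (- (beta * N * h)) <=
  Rpower 2 (nu + 1) * K / s * sqrt n * exp (- sigma).
Proof.
intros HM HN; assert (Hhp := step_pos); assert (Hs := sqrt_PI_d_mu_pos).
assert (Hsn := sqrt_n_ge_1).
assert (G : forall g L, mu <= g <= nu -> mu * n <= g * L ->
  K * Rpower 2 g / (g * h) * exp (- (g * L * h)) <=
  K * Rpower 2 nu / (mu * h) * exp (- sigma)).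
{ intros g L Hg HL.
  assert (0 < g * h) by nra; assert (0 < mu * h) by nra.
  assert (0 < Rpower 2 g) by apply exp_pos.
  apply Rmult_le_compat.
  - apply Rdiv_le_0_compat; nra.
  - apply Rlt_le, exp_pos.
  - apply Rmult_le_compat.
    + nra.
    + now apply Rlt_le, Rinv_0_lt_compat.
    + apply Rmult_le_compat_l; [lra|]; apply Rle_Rpower; lra.
    + apply Rinv_le_contravar; auto; nra.
  - apply exp_le; rewrite <- step_sigma_mu; nra. }
assert (G1 := G alpha M Ha HM); assert (G2 := G beta N Hb HN).
(* From [mu * n * h = sigma = s * sqrt n], after dividing by [n]. *)
assert (E : / (mu * h) = sqrt n / s).
{ assert (E1 := step_sigma_mu); assert (E2 := sigma_s).
  assert (E3 : sqrt n * sqrt n = n) by (apply sqrt_sqrt; lra).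
  apply Rmult_eq_reg_l with (mu * h * s); [|apply Rgt_not_eq; nra].
  replace (mu * h * s * / (mu * h)) with s by (field; lra).
  replace (mu * h * s * (sqrt n / s)) with (mu * h * sqrt n) by (field; lra).
  apply Rmult_eq_reg_r with (sqrt n); [|lra].
  replace (mu * h * sqrt n * sqrt n) with (mu * h * (sqrt n * sqrt n)) by ring.
  rewrite <- E2, <- E1, E3; ring. }
assert (P : Rpower 2 (nu + 1) = 2 * Rpower 2 nu)
  by (rewrite Rpower_plus, Rpower_1 by lra; ring).
unfold Rdiv in G1, G2 |- *; rewrite E in G1, G2; rewrite P; unfold Rdiv in *.
lra.
Qed.

Lemma discretization_le :
  (K * (Rpower 2 alpha / Rpower (cos d) alpha) / alpha +
   K * (Rpower 2 beta / Rpower (cos d) beta) / beta) /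
  (PI * (d * sinh (PI / h * d))) <=
  Rpower 2 (nu + 1) * K / s *
  (2 / (s * (1 - exp (- (2 * s))) * Rpower (cos d) nu)) *
  sqrt n * exp (- sigma).
Proof.
assert (HP := PI_RGT_0); assert (Hs := sqrt_PI_d_mu_pos); assert (Hsn := sqrt_n_ge_1).
assert (Hc : 0 < cos d <= 1) by (split; [apply cos_gt_0; lra|apply COS_bound]).
assert (Hcn : 0 < Rpower (cos d) nu) by apply exp_pos.
assert (H2n : 0 < Rpower 2 nu) by apply exp_pos.
assert (G : forall g, mu <= g <= nu ->
  K * (Rpower 2 g / Rpower (cos d) g) / g <=
  K * (Rpower 2 nu / Rpower (cos d) nu) / mu).
{ intros g Hg.
  assert (Hcg : 0 < Rpower (cos d) g) by apply exp_pos.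
  assert (H2g : 0 < Rpower 2 g) by apply exp_pos.
  assert (Hq : 0 < Rpower 2 g / Rpower (cos d) g) by now apply Rdiv_lt_0_compat.
  apply Rmult_le_compat; [nra|apply Rlt_le, Rinv_0_lt_compat; lra| |].
  - apply Rmult_le_compat_l; [lra|]; apply Rmult_le_compat; [lra| | |].
    + now apply Rlt_le, Rinv_0_lt_compat.
    + apply Rle_Rpower; lra.
    + apply Rinv_le_contravar; auto; apply Rpower_le_base_lt_1; lra.
  - apply Rinv_le_contravar; lra. }
assert (G1 := G alpha Ha); assert (G2 := G beta Hb).
rewrite step_sigma_d.
(* Since [2 * sinh sigma = exp sigma * (1 - exp (- (2 * sigma)))], replacing [sigma] by the smaller
   [s] in the last factor gives a constant free of [n]. *)
assert (Hss : s <= sigma) by (rewrite sigma_s; nra).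
set (w := 1 - exp (- (2 * s))).
assert (Hw : 0 < w).
{ unfold w; rewrite <- exp_0; apply Rlt_0_minus, exp_increasing; lra. }
assert (Hsinh : exp sigma * w / 2 <= sinh sigma).
{ unfold sinh, w.
  replace (exp (- sigma)) with (exp sigma * exp (- (2 * sigma)))
    by (rewrite <- exp_plus; f_equal; ring).
  assert (E : exp (- (2 * sigma)) <= exp (- (2 * s))) by (apply exp_le; lra).
  assert (He := exp_pos sigma); nra. }
assert (He := exp_pos sigma).
assert (Hden : 0 < exp sigma * w / 2) by (assert (0 < exp sigma * w) by nra; lra).
set (Q := K * (Rpower 2 nu / Rpower (cos d) nu) / mu) in *.
assert (HQ : 0 < Q).
{ apply Rdiv_lt_0_compat; auto; apply Rmult_lt_0_compat; auto.
  now apply Rdiv_lt_0_compat. }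
apply Rle_trans with ((Q + Q) / (PI * (d * (exp sigma * w / 2)))).
{ assert (0 < d * (exp sigma * w / 2)) by nra.
  assert (d * (exp sigma * w / 2) <= d * sinh sigma) by nra.
  apply Rle_trans with ((Q + Q) / (PI * (d * sinh sigma))).
  - apply Rmult_le_compat_r; [apply Rlt_le, Rinv_0_lt_compat; nra|lra].
  - apply Rmult_le_compat_l; [lra|]; apply Rinv_le_contravar; nra. }
assert (P : Rpower 2 (nu + 1) = 2 * Rpower 2 nu)
  by (rewrite Rpower_plus, Rpower_1 by lra; ring).
rewrite P, exp_Ropp.
set (X := 2 * Rpower 2 nu * K / s * (2 / (s * w * Rpower (cos d) nu)) * / exp sigma).
assert (HX : (Q + Q) / (PI * (d * (exp sigma * w / 2))) = X).
{ unfold X, Q.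
  replace (2 * Rpower 2 nu * K / s * (2 / (s * w * Rpower (cos d) nu))) with
    (4 * Rpower 2 nu * K / (s * s * w * Rpower (cos d) nu))
    by (field; repeat split; lra).
  rewrite sqrt_PI_d_mu_sqr; field; repeat split; lra. }
assert (HX0 : 0 < X).
{ rewrite <- HX; apply Rdiv_lt_0_compat; [lra|].
  apply Rmult_lt_0_compat; auto; apply Rmult_lt_0_compat; lra. }
rewrite HX.
(* The factor [sqrt n >= 1] is given away here to match the growth of the tails. *)
replace (_ * sqrt n * / exp sigma) with (X * sqrt n) by (unfold X; ring).
nra.
Qed.

Lemma total_le (M N : R) : mu * n <= alpha * M -> mu * n <= beta * N ->
  (K * (Rpower 2 alpha / Rpower (cos d) alpha) / alpha +
   K * (Rpower 2 beta / Rpower (cos d) beta) / beta) /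
    (PI * (d * sinh (PI / h * d))) +
  (K * Rpower 2 alpha / (alpha * h) * exp (- (alpha * M * h)) +
   K * Rpower 2 beta / (beta * h) * exp (- (beta * N * h))) <=
  bound_C1 d K mu nu * sqrt n * exp (- sigma).
Proof.
intros HM HN; assert (H1 := truncation_le M N HM HN).
assert (H2 := discretization_le); unfold bound_C1; fold s; lra.
Qed.

End Constants.

Theorem theorem2p3 (d : R) (f : C -> C) (K alpha beta : R)
  (hd : 0 < d < PI / 2)
  (hf : analytic_in f (image Csinh (strip d)))
  (hK : 0 < K) (halpha : 0 < alpha) (hbeta : 0 < beta)
  (hneg : forall z : C, image Csinh (strip_neg d) z ->
            Cmod (f z) <= K * Cmod (decayE1 z alpha))
  (hpos : forall z : C, image Csinh (strip_pos d) z ->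
            Cmod (f z) <= K * Cmod (decayE1 z beta))
  (n : nat) (hn : (0 < n)%nat) (mu nu h : R) (M N : Z)
  (hmu : mu = Rmin alpha beta) (hnu : nu = Rmax alpha beta)
  (hh : h = sqrt (PI * d / (mu * INR n)))
  (hMN_alpha : mu = alpha ->
     M = Z.of_nat n /\ N = Zceil (alpha * INR n / beta))
  (hMN_beta : mu = beta ->
     N = Z.of_nat n /\ M = Zceil (beta * INR n / alpha)) :
  Rbar_le
    (Lub_Rbar (fun y : R => exists t : R,
       y = Cmod (f (RtoC t) -
                 sum_Z (fun k : Z => f (Csinh (RtoC (IZR k * h))) *
                                     RtoC (Sinc k h (arcsinh t)))
                       (- M) N)%C))
    (Finite (bound_C1 d K mu nu * sqrt (INR n) * exp (- sqrt (PI * d * mu * INR n)))).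
Proof.
assert (Hn1 : 1 <= INR n) by (apply (le_INR 1); lia).
assert (Hceil : forall g k, 0 < g -> 0 < k ->
  (0 <= Zceil (g * INR n / k))%Z /\ g * INR n <= k * IZR (Zceil (g * INR n / k))).
{ intros g k Hg Hk; destruct (Zceil_bound (g * INR n / k)) as [_ H].
  assert (0 < g * INR n / k) by (apply Rdiv_lt_0_compat; nra).
  split; [apply le_IZR; lra|].
  apply Rmult_le_compat_l with (r := k) in H; [|lra].
  replace (k * (g * INR n / k)) with (g * INR n) in H by (field; lra); exact H. }
assert (HMN : 0 < mu /\ mu <= alpha <= nu /\ mu <= beta <= nu /\
  (0 <= M)%Z /\ (0 <= N)%Z /\
  mu * INR n <= alpha * IZR M /\ mu * INR n <= beta * IZR N).
{ unfold Rmin in hmu; unfold Rmax in hnu.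
  (* Whichever exponent is smaller, its side has exactly [n] nodes and meets the requirement with
     equality; rounding up secures the other side. *)
  destruct (Rle_dec alpha beta) as [L|L].
  - destruct (hMN_alpha hmu) as [-> ->]; rewrite hmu, hnu, <- INR_IZR_INZ.
    destruct (Hceil alpha beta halpha hbeta); repeat split; try lra; lia || auto.
  - destruct (hMN_beta hmu) as [-> ->]; rewrite hmu, hnu, <- INR_IZR_INZ.
    destruct (Hceil beta alpha hbeta halpha); repeat split; try lra; lia || auto. }
destruct HMN as (Hmu & Ha & Hb & HM & HN & HMn & HNn).
assert (Hhp : 0 < h) by (apply (step_pos d mu h (INR n)); auto).
(* The auxiliary width [d'] is later taken to be [d] for the strip and [0] for the real axis. *)
assert (HposF : forall d' u v, 0 <= d' < PI / 2 -> Rabs v <= d' -> Rabs v < d ->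
  0 <= u -> Cmod (f (Csinh (u, v))) <=
    K * (Rpower 2 beta / Rpower (cos d') beta) * exp (- beta * u)).
{ intros d' u v Hd' Hv Hvd Hu; eapply Rle_trans.
  - apply hpos; exists (u, v); repeat split; auto.
  - rewrite Rmult_assoc; apply Rmult_le_compat_l; [lra|].
    rewrite <- (Rabs_pos_eq u) at 2 by lra; now apply decayE1_bound. }
assert (HnegF : forall d' u v, 0 <= d' < PI / 2 -> Rabs v <= d' -> Rabs v < d ->
  u < 0 -> Cmod (f (Csinh (u, v))) <=
    K * (Rpower 2 alpha / Rpower (cos d') alpha) * exp (alpha * u)).
{ intros d' u v Hd' Hv Hvd Hu; eapply Rle_trans.
  - apply hneg; exists (u, v); repeat split; auto.
  - rewrite Rmult_assoc; apply Rmult_le_compat_l; [lra|].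
    replace (alpha * u) with (- alpha * Rabs u) by (rewrite Rabs_left; lra).
    now apply decayE1_bound. }
assert (Hq : forall g c, 0 <= K * (Rpower 2 g / Rpower c g)).
{ intros g c; apply Rmult_le_pos; [lra|].
  apply Rdiv_le_0_compat; [apply Rlt_le, exp_pos|apply exp_pos]. }
assert (Hreal : forall g, Rpower 2 g / Rpower (cos 0) g = Rpower 2 g).
{ intros g; rewrite cos_0; unfold Rpower at 2; rewrite ln_1, Rmult_0_r, exp_0; field. }
apply (proj2 (Lub_Rbar_correct _)); intros e [t ->]; simpl.
set (x := arcsinh t).
(* The substitution [t = sinh x] turns the approximation of [f] at [t] into that of the composite
   with [Csinh] at the real point [x], with a bound that does not depend on [x]. *)
assert (Ht : RtoC t = Csinh (RtoC x))
  by (unfold x; now rewrite Csinh_RtoC, sinh_arcsinh).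
rewrite Ht.
eapply Rle_trans; [apply (sinc_approximation_error (fun z => f (Csinh z)) d h
  (proj1 hd) Hhp (composed_diff f d hf) alpha beta
  (K * (Rpower 2 alpha / Rpower (cos d) alpha))
  (K * (Rpower 2 beta / Rpower (cos d) beta))
  (K * Rpower 2 alpha) (K * Rpower 2 beta)); auto|].
- rewrite <- (Hreal alpha); apply Hq.
- rewrite <- (Hreal beta); apply Hq.
- intros [u v] Hv Hu; simpl in *; apply HposF; auto; lra.
- intros [u v] Hv Hu; simpl in *; apply HnegF; auto; lra.
- intros u Hu; rewrite <- (Hreal beta); apply HposF; rewrite ?Rabs_R0; lra.
- intros u Hu; rewrite <- (Hreal alpha); apply HnegF; rewrite ?Rabs_R0; lra.
- apply (total_le d K alpha beta mu nu h (INR n)); auto.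
Qed.
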